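(* Let $(\mathcal E,\mathcal F)$ be a transient, regular, symmetric Dirichlet form on $L^2(E;m)$ whose associated Hunt process $X$ is irreducible (I) and strong Feller (SF). Suppose that both $m$ and $\mu$ belong to $\mathcal K_\infty$, and put $$\lambda(\mu)=\inf\Big\{\mathcal E(u,u)\,\Big|\,u\in\mathcal F,\int_Eu^2d\mu=1\Big\},\qquad \gamma(\mu)=\inf\Big\{\mathcal E(u,u)-\int_Eu^2d\mu\,\Big|\,u\in\mathcal F,\int_Eu^2dm=1\Big\}.$$ Then $\lambda(\mu)>1$ if and only if $\gamma(\mu)>0$.
   Context: $E$ is a locally compact separable metric space, $m$ a positive Radon measure on $E$ with full topological support; $\zeta$ is the lifetime of $X=(\mathbf P_x,X_t,\zeta)$; $p_tf(x)=\mathbf E_x(f(X_t);t<\zeta)$; functions in $\mathcal F$ are represented by quasi-continuous versions; $\inf\emptyset=\infty$. (I): any Borel set $A$ with $p_t(1_Af)=1_Ap_tf$ $m$-a.e. for all bounded Borel $f\in L^2(E;m)$, $t>0$, satisfies $m(A)=0$ or $m(E\setminus A)=0$. (SF): $p_t$ maps bounded Borel functions to bounded continuous functions for each $t>0$. Kato classes: under (SF) the resolvent $R_\alpha$ has a density $r_\alpha(x,y)$ with respect to $m$, non-negative, jointly measurable and $\alpha$-excessive in each variable ($\alpha\ge0$; $r=r_0$); $R_\alpha\nu(x)=\int_Er_\alpha(x,y)\,\nu(dy)$, $R\nu=R_0\nu$. A Borel measure $\mu$ is smooth in the strict sense if there are Borel sets $E_n$ such that each $1_{E_n}\mu$ is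 a finite measure of finite energy integral with $\sup_xR_1(1_{E_n}\mu)(x)<\infty$ and $\mathbf P_x(\lim_n\sigma_n\ge\zeta)=1$ for all $x\in E$, where $\sigma_n=\inf\{t>0:X_t\in E\setminus E_n\}$. Such $\mu$ is in $\mathcal K$ if $\lim_{\alpha\to\infty}\sup_{x}R_\alpha\mu(x)=0$. $\mathcal K_\infty$ is the set of $\mu\in\mathcal K$ such that for every $\epsilon>0$ there is a compact $K$ with $\sup_{x}R(1_{K^c}\mu)(x)<\epsilon$. *)

(* Defs.v *)
From HB Require Import structures.
From mathcomp Require Import all_boot all_order all_algebra.
From mathcomp Require Import all_classical all_reals all_analysis.
From mathcomp Require Import measurable_realfun.

Set Implicit Arguments.
Unset Strict Implicit.
Unset Printing Implicit Defensive.

Import Order.TTheory GRing.Theory Num.Theory.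
Import numFieldNormedType.Exports.

Local Open Scope classical_set_scope.
Local Open Scope ring_scope.

(* The library's measurable types are pointed; being pointed only says that a
   metric space is nonempty. *)
#[short(type="pmetricType")]
HB.structure Definition PMetric (K : numDomainType) :=
  {M of Metric K M & isPointed M}.

(* Same carrier as T, with the Borel sigma-algebra as measurable structure. *)
Notation borel T := (g_sigma_algebraType (@open T)).

(* The cemetery is None.  When E is compact, None is an isolated point. *)
Notation cemetery_ext E := (one_point_compactification E).

Section state_space.
Context {R : realType} (E : pmetricType R).

Definition lcs_metric : Prop :=
  locally_compact [set: E] /\ exists2 A : set E, countable A & dense A.

(* On a locally compact separable metric space, a Borel measure that is finite
   on compact sets is automatically inner and outer regular. *)
Definition radon_full_support (m : {measure set (borel E) -> \bar R}) : Prop :=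
  (forall K : set E, compact K -> (m K < +oo)%E) /\
  (forall U : set E, open U -> U !=set0 -> (0 < m U)%E).

Definition bounded_borel (f : E -> R) : Prop :=
  measurable_fun [set: borel E] (f : borel E -> R) /\
  exists M : R, forall x, `|f x| <= M.

Definition nonneg_borel (f : E -> \bar R) : Prop :=
  measurable_fun [set: borel E] (f : borel E -> \bar R) /\
  forall x, (0 <= f x)%E.

Definition compactly_supported_continuous (f : E -> R) : Prop :=
  continuous f /\ exists2 K : set E, compact K & forall x, ~ K x -> f x = 0.

End state_space.

Section dirichlet_forms.
Context {R : realType} {E : pmetricType R}.
Variable m : {measure set (borel E) -> \bar R}.

(* Elements of the domain are Borel functions rather than classes; dom_ae says
   that the domain and the form only depend on the m-a.e. class. *)
Record dirichlet_form : Type := DirichletForm {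
  dom : set (E -> R) ;
  energy : (E -> R) -> (E -> R) -> R ;
  energy1 := fun u v => energy u v + \int[m]_x (u x * v x) ;
  dom_L2 : forall u, dom u -> (u : borel E -> R) \in Lfun m 2%:E ;
  dom_ae : forall u v : borel E -> R, dom u -> measurable_fun setT v ->
    u = v %[ae m] ->
    dom v /\ forall w, dom w -> energy v w = energy u w ;
  dom_linear : forall (a : R) u v, dom u -> dom v ->
    dom (fun x => a * u x + v x) ;
  dom_dense : forall f : borel E -> R, f \in Lfun m 2%:E ->
    forall e : R, 0 < e ->
    exists2 u, dom u & ('N[m]_2%:E[EFin \o (f \- u)%R] < e%:E)%E ;
  energy_sym : forall u v, dom u -> dom v -> energy u v = energy v u ;
  energy_linear : forall (a : R) u v w, dom u -> dom v -> dom w ->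
    energy (fun x => a * u x + v x) w = a * energy u w + energy v w ;
  energy_ge0 : forall u, dom u -> 0 <= energy u u ;
  energy_closed : forall u_ : nat -> E -> R, (forall n, dom (u_ n)) ->
    (forall e : R, 0 < e -> exists N : nat, forall i j : nat,
      (N <= i)%N -> (N <= j)%N ->
      energy1 (fun x => u_ i x - u_ j x) (fun x => u_ i x - u_ j x) < e) ->
    exists2 u, dom u &
      energy1 (fun x => u_ n x - u x) (fun x => u_ n x - u x)
        @[n --> \oo] --> (0 : R) ;
  energy_markov : forall u, dom u ->
    let v := fun x => Num.min (Num.max 0 (u x)) 1 in
    dom v /\ energy v v <= energy u u
}.

Variable D : dirichlet_form.

Definition regular_form : Prop :=
  (forall u, dom D u -> forall e : R, 0 < e ->
    exists v, [/\ dom D v, compactly_supported_continuous v &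
      energy1 D (fun x => u x - v x) (fun x => u x - v x) < e]) /\
  (forall f : E -> R, compactly_supported_continuous f ->
    forall e : R, 0 < e ->
    exists v, [/\ dom D v, compactly_supported_continuous v &
      forall x, `|f x - v x| < e]).

Definition open_capacity (G : set E) : \bar R :=
  ereal_inf [set (energy1 D u u)%:E | u in
    [set u | dom D u /\ \forall x \ae m, G x -> 1 <= u x]].

Definition quasi_continuous (u : E -> R) : Prop :=
  forall e : R, 0 < e -> exists G : set E,
    [/\ open G, (open_capacity G < e%:E)%E & {within ~` G, continuous u}].

(* 1_A mu is a measure of finite energy integral. *)
Definition finite_energy_integral_on (mu : {measure set (borel E) -> \bar R})
    (A : set E) : Prop :=
  exists C : R, forall v, dom D v -> compactly_supported_continuous v ->
    (\int[mu]_(x in A) `|v x|%:E <= (C * Num.sqrt (energy1 D v v))%:E)%E.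

Definition lambda (mu : {measure set (borel E) -> \bar R}) : \bar R :=
  ereal_inf [set (energy D u u)%:E | u in
    [set u | [/\ dom D u, quasi_continuous u &
      (\int[mu]_x (u x ^+ 2)%:E = 1)%E]]].

Definition gamma (mu : {measure set (borel E) -> \bar R}) : \bar R :=
  ereal_inf [set ((energy D u u)%:E - \int[mu]_x (u x ^+ 2)%:E)%E | u in
    [set u | [/\ dom D u, quasi_continuous u &
      (\int[m]_x (u x ^+ 2)%:E = 1)%E]]].

End dirichlet_forms.

Section filtrations.
Context {R : realType} d (Omega : measurableType d).
Variable M : R -> set (set Omega).

Definition right_continuous_filtration : Prop :=
  [/\ forall t, 0 <= t -> sigma_algebra [set: Omega] (M t),
      forall t, 0 <= t -> M t `<=` measurable,
      forall s t, 0 <= s -> s <= t -> M s `<=` M t &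
      forall t, 0 <= t -> \bigcap_(s in [set s | t < s]) M s `<=` M t].

Definition stopping_time (tau : Omega -> \bar R) : Prop :=
  (forall w, (0 <= tau w)%E) /\
  forall t : R, 0 <= t -> M t [set w | (tau w <= t%:E)%E].

Definition stopped_sigma_algebra (tau : Omega -> \bar R) : set (set Omega) :=
  [set A | measurable A /\
    forall t : R, 0 <= t -> M t (A `&` [set w | (tau w <= t%:E)%E])].

End filtrations.

Section hunt.
Context {R : realType} (E : pmetricType R).
Let Ed := cemetery_ext E.

(* Only nonnegative times are meaningful.  The strong Markov property is the
   defining identity of P_x(X_(tau+s) \in B | M_tau) = P_(X_tau)(X_s \in B) on
   {tau < +oo}, integrated over the members A of M_tau; with tau constant it
   contains the Markov property.  Since the filtration M does not depend on x,
   imposing it (and quasi-left-continuity) under all P_x imposes it under all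
   initial laws. *)
Record hunt_process : Type := HuntProcess {
  sample_display : measure_display ;
  sample : measurableType sample_display ;
  path : R -> sample -> Ed ;
  law : Ed -> probability sample R ;
  lifetime := fun w : sample =>
    ereal_inf [set t%:E | t in [set t : R | 0 <= t /\ path t w = None]] ;
  path_measurable : forall t, 0 <= t ->
    measurable_fun [set: sample] (path t : sample -> borel Ed) ;
  law_measurable : forall t (B : set (borel Ed)), 0 <= t -> measurable B ->
    measurable_fun [set: borel Ed]
      ((fun x => law x (path t @^-1` B)) : borel Ed -> \bar R) ;
  path_normal : forall x, {ae law x, forall w, path 0 w = x} ;
  path_absorbed : forall w (t : R), (lifetime w <= t%:E)%E -> path t w = None ;
  path_shift : forall t, 0 <= t -> exists theta : sample -> sample,
    forall s w, 0 <= s -> path s (theta w) = path (t + s) w ;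
  path_right_continuous : forall w t, 0 <= t ->
    path s w @[s --> t^'+] --> path t w ;
  path_left_limits : forall w t, 0 < t ->
    exists l : Ed, path s w @[s --> t^'-] --> l ;
  strong_markov_quasi_left_continuous : exists M : R -> set (set sample),
    [/\ right_continuous_filtration M,
        forall t (B : set (borel Ed)), 0 <= t -> measurable B ->
          M t (path t @^-1` B),
        forall (x : Ed) tau A s (B : set (borel Ed)),
          stopping_time M tau -> stopped_sigma_algebra M tau A ->
          0 <= s -> measurable B ->
          law x (A `&` [set w | (tau w < +oo)%E /\
                                B (path (fine (tau w) + s) w)]) =
          (\int[law x]_(w in A `&` [set w | (tau w < +oo)%E])
             law (path (fine (tau w)) w) (path s @^-1` B))%E &
        forall (x : Ed) tau_ tau,
          (forall n, stopping_time M (tau_ n)) -> stopping_time M tau ->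
          (forall n w, (tau_ n w <= tau_ n.+1 w)%E) ->
          (forall w, tau_ n w @[n --> \oo] --> tau w) ->
          {ae law x, forall w, (tau w < +oo)%E ->
            path (fine (tau_ n w)) w @[n --> \oo]
              --> path (fine (tau w)) w}]
}.

Variable X : hunt_process.

Definition semigroup (t : R) (f : E -> \bar R) (x : E) : \bar R :=
  (\int[law X (Some x)]_(w in [set w | (t%:E < lifetime w)%E])
     oapp f 0 (path t w))%E.

Definition resolvent (a : R) (f : E -> \bar R) (x : E) : \bar R :=
  (\int[lebesgue_measure]_(t in `[0%R, +oo[%classic)
     ((expR (- (a * t)))%:E * semigroup t f x))%E.

(* inf {t > 0 | X_t \in A} *)
Definition hitting_time (A : set E) (w : sample X) : \bar R :=
  ereal_inf [set t%:E | t in [set t : R | 0 < t /\ (Some @` A) (path t w)]].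

Definition strong_feller : Prop :=
  forall (t : R) (f : E -> R), 0 < t -> bounded_borel f ->
    continuous (fun x => fine (semigroup t (EFin \o f) x)) /\
    exists M : R, forall x, `|fine (semigroup t (EFin \o f) x)| <= M.

Definition excessive (a : R) (f : E -> \bar R) : Prop :=
  [/\ nonneg_borel f,
      forall t x, 0 <= t ->
        ((expR (- (a * t)))%:E * semigroup t f x <= f x)%E &
      forall x, ((expR (- (a * t)))%:E * semigroup t f x)%E
        @[t --> 0^'+] --> f x].

Variable m : {measure set (borel E) -> \bar R}.

Definition irreducible_process : Prop :=
  forall A : set (borel E), measurable A ->
    (forall (f : E -> R) (t : R), bounded_borel f ->
       (f : borel E -> R) \in Lfun m 2%:E -> 0 < t ->
       {ae m, forall x,
         semigroup t (fun y => (\1_A y * f y)%:E) x =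
         ((\1_A x)%:E * semigroup t (EFin \o f) x)%E}) ->
    m A = 0%E \/ m (~` A) = 0%E.

(* Transience of the semigroup: the Green operator is finite m-a.e. on
   nonnegative integrable functions. *)
Definition transient_semigroup : Prop :=
  forall f : E -> \bar R, nonneg_borel f -> (\int[m]_x f x < +oo)%E ->
    {ae m, forall x, (resolvent 0 f x < +oo)%E}.

(* (u - p_t u, v) / t, in L^2(m) *)
Definition approximating_form (t : R) (u v : E -> R) : R :=
  t^-1 * \int[m]_x ((u x - fine (semigroup t (EFin \o u) x)) * v x).

(* The semigroup of X is m-symmetric and D is its Dirichlet form:
   dom D = {u \in L^2 | lim_(t -> 0) (u - p_t u, u) / t < +oo},
   energy D u v = lim_(t -> 0) (u - p_t u, v) / t. *)
Definition associated (D : dirichlet_form m) : Prop :=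
  [/\ forall (t : R) (f g : E -> \bar R), 0 < t ->
        nonneg_borel f -> nonneg_borel g ->
        (\int[m]_x (f x * semigroup t g x) =
         \int[m]_x (semigroup t f x * g x))%E,
      forall u : E -> R, dom D u <->
        (u : borel E -> R) \in Lfun m 2%:E /\
        exists l : R, approximating_form t u u @[t --> 0^'+] --> l &
      forall u v, dom D u -> dom D v ->
        approximating_form t u v @[t --> 0^'+] --> energy D u v].

(* These conditions determine r: two alpha-excessive densities agree m-a.e. in
   y, hence everywhere. *)
Definition resolvent_density (r : R -> E -> E -> \bar R) : Prop :=
  forall a : R, 0 <= a ->
  [/\ measurable_fun [set: borel E * borel E]
        ((fun z => r a z.1 z.2) : borel E * borel E -> \bar R),
      forall f x, nonneg_borel f ->
        resolvent a f x = (\int[m]_y (r a x y * f y))%E,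
      forall x, excessive a (fun y => r a x y) &
      forall y, excessive a (fun x => r a x y)].

End hunt.

Section kato.
Context {R : realType} {E : pmetricType R}.
Context {m : {measure set (borel E) -> \bar R}}.
Variables (D : dirichlet_form m) (X : hunt_process E).
Variable r : R -> E -> E -> \bar R.
Variable mu : {measure set (borel E) -> \bar R}.

(* R_a (1_A mu) (x) *)
Definition potential (a : R) (A : set E) (x : E) : \bar R :=
  (\int[mu]_(y in A) r a x y)%E.

Definition sup_potential (a : R) (A : set E) : \bar R :=
  ereal_sup (range (potential a A)).

Definition smooth_strict : Prop :=
  exists E_ : nat -> set (borel E),
  [/\ forall n, [/\ measurable (E_ n), (mu (E_ n) < +oo)%E,
                    finite_energy_integral_on D mu (E_ n) &
                    (sup_potential 1 (E_ n) < +oo)%E] &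
      forall x : E, {ae law X (Some x), forall w,
        exists2 l : \bar R,
          hitting_time (~` E_ n) w @[n --> \oo] --> l &
          (lifetime w <= l)%E}].

Definition kato : Prop :=
  smooth_strict /\ sup_potential a setT @[a --> +oo%R] --> 0%E.

Definition kato_infty : Prop :=
  kato /\ forall e : R, 0 < e -> exists2 K : set E,
    compact K & (sup_potential 0 (~` K) < e%:E)%E.

End kato.

(* Main.v *)
Require Import Defs.
From HB Require Import structures.
From mathcomp Require Import all_boot all_order all_algebra.
From mathcomp Require Import all_classical all_reals all_analysis.
From mathcomp Require Import measurable_realfun ring lra.

Set Implicit Arguments.
Unset Strict Implicit.
Unset Printing Implicit Defensive.

Import Order.TTheory GRing.Theory Num.Theory.
Import numFieldNormedType.Exports.

Local Open Scope classical_set_scope.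
Local Open Scope ring_scope.
Local Open Scope ereal_scope.

(* Both implications come from two coercivity estimates: a Poincare inequality
   \int u^2 dm <= C E(u,u), and, for a large a,
   \int u^2 dmu <= (E(u,u) + a \int u^2 dm) / 2, after which only scaling and
   elementary algebra remain.

   The estimates rest on a Hardy inequality: for an a-supermedian h >= c > 0,
   AM-GM and symmetry give
   \int u^2 (h - P_t h) / h dm <= (u - e^(-at) p_t u, u).  If h is a potential
   U f <= N, then h - P_t h = \int_0^t P_s f ds, so dividing by t and letting
   t -> 0, Fatou's lemma yields \int u^2 f dm <= 2N (E(u,u) + a \int u^2 dm)
   for lower semicontinuous f; this is enough for the Poincare inequality, where
   the space is split into the complement of a compact set K, the part of K where a
   potential U_0 1_G is at most N, and the part where it exceeds N, whose
   1-potential is small on K by Dini's argument.  For the potential of mu the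
   same limit bounds \int g dmu for lower semicontinuous g <= u_1^2 + u_2^2
   m-a.e.; a quasi-continuous u is reached by taking g equal to k on an open set
   of small capacity and to min(u^2, k) elsewhere. *)

(** The obstacle is that [mu] may charge m-null sets, while the form and the Hardy inequality only
    see m-classes. Two facts carry m-a.e. information over to [mu]. The identity \int r(x,y) g(x)
    m(dx) = U g(y) holds for every y; it turns \int g (h - P_t h) dm, for h the potential of [mu],
    into the [mu]-integral of \int_0^t P_s g ds. And for lower semicontinuous g the short-time
    averages of P_s g have lower limit at least g at every point, because paths are
    right-continuous, so no exceptional set has to be discarded. The same identity makes r(., y)
    positive somewhere for every y, from which [mu] is seen to be sigma-finite, as Tonelli requires.
    Truncating h at N and adding N gives a function between N and 2N whose decrease under P_t
    dominates that of h where h <= N; this is the source of the factor 2N. The bound N = 1/4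
    therefore gives the coefficient 1/2: for [mu] it leaves the slack needed to compare with 1, and
    in the Poincare inequality it lets half of \int u^2 dm be absorbed on the left. *)

(** * Borel structure of the cemetery extension *)

Section borel_sets.
Context {R : realType} (E : pmetricType R).
Let Ed := cemetery_ext E.

Lemma open_borel (T : ptopologicalType) (U : set T) :
  open U -> measurable (U : set (borel T)).
Proof. by move=> oU; apply: sub_sigma_algebra. Qed.

Lemma measurable_some : measurable_fun [set: borel E] (Some : borel E -> borel Ed).
Proof.
apply: (@measurability _ _ (borel E) (borel Ed) setT Some (@open Ed)) => //.
move=> _ [U oU <-]; rewrite setTI; apply: open_borel.
have /continuousP := @one_point_compactification_some_continuous E; exact.
Qed.

(** A good-sets argument: [Some] is injective and open, so images of open sets are open and the
    image of a complement is a difference inside the open range. *)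
Lemma measurable_image_some (A : set (borel E)) : measurable A ->
  measurable (Some @` A : set (borel Ed)).
Proof.
have mT : measurable (Some @` [set: E] : set (borel Ed)).
  by apply: open_borel; apply: one_point_compactification_open_some; exact: openT.
move=> mA; pose P := [set A : set (borel E) | measurable (Some @` A : set (borel Ed))].
suff: <<s @open E >> `<=` P by apply.
apply: smallest_sub; last first.
  by move=> U oU; apply: open_borel; exact: one_point_compactification_open_some.
split.
- by rewrite /P/= image_set0.
- move=> B PB; rewrite /P/= (_ : _ @` _ = (Some @` [set: E]) `\` (Some @` B)).
    exact: measurableD.
  apply/seteqP; split=> [_ [x [_ Bx] <-]|_ [[x _ <-] nB]].
    by split; [exists x|move=> [y By [yx]]; apply: Bx; rewrite -yx].
  by exists x => //; split=> // Bx; apply: nB; exists x.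
- move=> F PF; rewrite /P/= image_bigcup; exact: bigcupT_measurable.
Qed.

Lemma measurable_oapp (f : E -> \bar R) :
  measurable_fun [set: borel E] (f : borel E -> \bar R) ->
  measurable_fun [set: borel Ed] (fun z : borel Ed => oapp f 0 z).
Proof.
move=> mf _ B mB; rewrite setTI.
have mS : measurable (Some @` (f @^-1` B) : set (borel Ed)).
  by apply: measurable_image_some; rewrite -[X in measurable X]setTI; exact: mf.
have mT : measurable (Some @` [set: E] : set (borel Ed)).
  by apply: measurable_image_some; exact: measurableT.
(* The cemetery carries the value 0, so it lies in the preimage of [B] exactly when 0 is in [B]. *)
have [B0|B0] := pselect (B 0).
  rewrite (_ : _ @^-1` _ = (Some @` (f @^-1` B)) `|` ~` (Some @` [set: E])).
    by apply: measurableU => //; exact: measurableC.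
  apply/seteqP; split=> [[x|]/= Bx|[x|]/=].
  - by left; exists x.
  - by right; case.
  - by case=> [[y By [<-]]|] //; case; exists x.
  - by [].
rewrite (_ : _ @^-1` _ = (Some @` (f @^-1` B))) //.
by apply/seteqP; split=> [[x|]/= Bx|[x|]/=] //; [exists x|case=> y By [<-]|case].
Qed.

End borel_sets.

(** * The transition measures of the process, killed at the lifetime *)

Section transition.
Context {R : realType} (E : pmetricType R) (X : hunt_process E).
Let Ed := cemetery_ext E.
Local Notation pth t := (Defs.path t : sample X -> borel Ed).

(* Times are clipped at 0 so that the kernel is defined on all of R. *)
Definition transition (t : R) (x : E) (A : set (borel E)) : \bar R :=
  law X (Some x) (pth (Num.max 0 t)%R @^-1` (Some @` A)).

Lemma measurable_path_preimage (t : R) (A : set (borel E)) : measurable A ->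
  measurable (pth (Num.max 0 t)%R @^-1` (Some @` A)).
Proof.
move=> mA; rewrite -[X in measurable X]setTI.
apply: (@path_measurable _ _ X (Num.max 0 t)%R) => //.
  by rewrite le_max lexx.
exact: measurable_image_some.
Qed.

Let transition0 t x : transition t x set0 = 0.
Proof. by rewrite /transition image_set0 preimage_set0 measure0. Qed.

Let transition_ge0 t x A : 0 <= transition t x A.
Proof. exact: measure_ge0. Qed.

Let transition_sigma_additive t x : semi_sigma_additive (transition t x).
Proof.
move=> F mF tF mUF; rewrite /transition image_bigcup preimage_bigcup.
apply: measure_semi_sigma_additive.
- by move=> n; exact: measurable_path_preimage.
- apply/trivIsetP => i j _ _ ij; rewrite -preimage_setI.
  rewrite (_ : _ `&` _ = set0) ?preimage_set0//.
  apply/seteqP; split=> // _ [[y Fy <-] [z Fz [zy]]].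
  have /trivIsetP/(_ i j I I ij)/seteqP[+ _] := tF.
  by apply; split; [exact: Fy|rewrite -zy].
- by apply: bigcupT_measurable => n; exact: measurable_path_preimage.
Qed.

HB.instance Definition _ t x := isMeasure.Build _ _ _ (transition t x)
  (transition0 t x) (transition_ge0 t x) (@transition_sigma_additive t x).

Lemma transition_le1 t x : transition t x setT <= 1.
Proof. by apply: probability_le1; exact: measurable_path_preimage. Qed.

Lemma measurable_transition t (A : set (borel E)) : measurable A ->
  measurable_fun [set: borel E] ((fun x => transition t x A) : borel E -> \bar R).
Proof.
move=> mA; have t0 : (0 <= Num.max 0 t)%R by rewrite le_max lexx.
exact: measurableT_comp (law_measurable X t0 (measurable_image_some mA))
  (@measurable_some R E).
Qed.

(** The infimum alone shows that a path is alive before its lifetime; the converse is absorption at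
    the cemetery. *)
Lemma lifetime_gtP (t : R) (w : sample X) : (0 <= t)%R ->
  (t%:E < lifetime w) = (pth t w != None).
Proof.
move=> t0; apply/idP/idP; last first.
  by move=> pt; rewrite ltNge; apply/negP => /path_absorbed; exact/eqP.
move=> tl; apply/eqP => pt; move: tl; apply/negP; rewrite -leNgt.
by apply: ereal_inf_lbound; exists t.
Qed.

Lemma transition_fin t x : fin_num_fun (transition t x).
Proof.
move=> U mU; rewrite ge0_fin_numE// (@le_lt_trans _ _ 1) ?ltry//.
exact/probability_le1/measurable_path_preimage.
Qed.

HB.instance Definition _ t x := @Measure_isFinite.Build _ _ _ (transition t x)
  (@transition_fin t x).

(** A path may be dead at time [t], so [transition t x] is not an image of the law on [E]. Both
    measures are pushed to the extended space, where they agree on subsets of the range of [Some];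
    the cemetery contributes 0. *)
Lemma integral_transition (t : R) (f : E -> \bar R) (x : E) : (0 <= t)%R ->
  nonneg_borel f ->
  \int[transition t x]_y f y = \int[law X (Some x)]_w oapp f 0 (pth t w).
Proof.
move=> t0 [mf f0].
have mp : measurable_fun setT (pth t) := path_measurable t0.
have mo := measurable_oapp mf.
have o0 (z : borel Ed) : 0 <= oapp f 0 z by case: z => [y|] //=.
have mT : measurable (Some @` [set: E] : set (borel Ed)).
  by apply: measurable_image_some; exact: measurableT.
have ms := @measurable_some R E.
pose sm : {mfun borel E >-> borel Ed} := HB.pack (Some : borel E -> borel Ed)
  (isMeasurableFun.Build _ _ _ _ _ ms).
pose pm : {mfun sample X >-> borel Ed} := HB.pack (pth t)
  (isMeasurableFun.Build _ _ _ _ _ mp).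
transitivity (\int[pushforward (transition t x) sm]_(z in Some @` [set: E]) oapp f 0 z).
  rewrite (ge0_integral_pushforward ms)//; last by apply: measurable_funS mo.
  rewrite (_ : _ @^-1` _ = setT) //.
  by apply/seteqP; split=> // y _; exists y.
transitivity (\int[pushforward (law X (Some x)) pm]_(z in Some @` [set: E]) oapp f 0 z).
  apply: eq_measure_integral => A mA AS.
  rewrite /= /pushforward /= /transition max_r//; congr (law X (Some x) _).
  congr (_ @^-1` _); apply/seteqP; split=> [_ [y Ay <-]//|z Az].
  by have [y _ yz] := AS z Az; exists y => //=; rewrite yz.
rewrite (ge0_integral_pushforward mp)//; last by apply: measurable_funS mo.
rewrite [RHS]integral_mkcond [LHS]integral_mkcond; apply: eq_integral => w _.
rewrite !patchE in_setT; case: ifPn => //; rewrite notin_setE /=.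
by case: (pth t w) => [y|]// /(_ (ex_intro2 _ _ y I erefl)).
Qed.

Lemma semigroupE (t : R) (f : E -> \bar R) (x : E) : (0 <= t)%R ->
  nonneg_borel f ->
  semigroup X t f x = \int[transition t x]_y f y.
Proof.
move=> t0 nf; rewrite integral_transition// /semigroup integral_mkcond.
apply: eq_integral => w _; rewrite patchE.
case: ifPn => //; rewrite notin_setE /= lifetime_gtP// => /negP.
by rewrite negbK => /eqP ->.
Qed.

End transition.

Lemma cvgn_at_right (R : realType) (u : nat -> R) (s : R) :
  (forall n, (s < u n)%R) -> u @ \oo --> s -> u @ \oo --> s^'+.
Proof.
move=> su us A sA.
have H : \forall n \near \oo, (s < u n)%R -> A (u n) by exact: us _ sA.
suff : \forall n \near \oo, A (u n) by [].
by apply: filterS H => n /(_ (su n)).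
Qed.

(** * Continuous functions increasing to the indicator of an open set *)

Section open_approximation.
Context {R : realType} (E : pmetricType R) (G : set E).
Hypothesis oG : open G.

(** Distance to the complement of [G], cut at 1 since [edist_inf] is infinite when that complement
    is empty. *)
Let psi (z : E) : R := fine (mine 1 (edist_inf (~` G) z)).

Let psiE z : (psi z)%:E = mine 1 (edist_inf (~` G) z).
Proof.
rewrite /psi fineK// ge0_fin_numE; first by rewrite gt_min ltry.
by rewrite le_min lee01 edist_inf_ge0.
Qed.

Let psi_ge0 z : (0 <= psi z)%R.
Proof. by rewrite -lee_fin psiE le_min lee01 edist_inf_ge0. Qed.

Let psi0 z : ~ G z -> psi z = 0%R.
Proof.
move=> nG; apply: EFin_inj; rewrite psiE edist_inf0//.
by rewrite min_r// lee01.
Qed.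

Let psi_gt0 z : G z -> (0 < psi z)%R.
Proof.
move=> Gz; rewrite -lte_fin psiE lt_min lte01/=.
have /nbhs_ballP[e /= e0 eG] : nbhs z G by exact: open_nbhs_nbhs.
apply: (@lt_le_trans _ _ e%:E); first by rewrite lte_fin.
apply: le_ereal_inf_tmp => _ [a nGa <-]; rewrite leNgt; apply/negP.
by move=> /edist_lt_ball/= /eG.
Qed.

Let psi_lipschitz (e : R) y z : (0 < e)%R -> ball z e y -> (psi y <= e + psi z)%R.
Proof.
move=> e0 zey; rewrite -lee_fin EFinD !psiE.
have [_|_] := leP 1 (edist_inf (~` G) z).
  by rewrite ge_min leeDr// lee_fin ltW.
rewrite ge_min; apply/orP; right.
apply: (le_trans (edist_inf_triangle _ y z)); apply: leeD => //.
by apply: edist_fin => //=; exact: ball_sym.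
Qed.

Let psi_continuous : continuous psi.
Proof.
move=> z; apply/cvgrPdist_le => e e0; near=> y.
have zy : ball z e y by near: y; exact: nbhsx_ballx.
rewrite ler_distl lerBlDl psi_lipschitz//= addrC psi_lipschitz//.
exact: ball_sym.
Unshelve. all: by end_near. Qed.

Definition open_approx (n : nat) (z : E) : R := Num.min 1%R (n%:R * psi z)%R.

Lemma open_approx_continuous n : continuous (open_approx n).
Proof.
move=> z; apply: (@continuous_min R E (cst 1%R) (fun z => n%:R * psi z)%R).
  exact: cvg_cst.
by apply: cvgM; [exact: cvg_cst|exact: psi_continuous].
Qed.

Lemma open_approx_ge0 n z : (0 <= open_approx n z)%R.
Proof. by rewrite le_min ler01 mulr_ge0. Qed.

Lemma open_approx_le1 n z : (open_approx n z <= 1)%R.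
Proof. by rewrite ge_min lexx. Qed.

Lemma open_approx_nondecreasing z : {homo open_approx^~ z : n p / (n <= p)%N >-> (n <= p)%R}.
Proof.
move=> n p np; rewrite /open_approx le_min ge_min lexx/= ge_min.
by rewrite ler_wpM2r ?ler_nat ?orbT.
Qed.

Lemma open_approx_near1 z : G z ->
  \forall n \near \oo, open_approx n z = 1%R.
Proof.
move=> Gz; near=> n; rewrite /open_approx min_l//.
rewrite -ler_pdivrMr ?psi_gt0// mul1r.
near: n; exact: nbhs_infty_ger.
Unshelve. all: by end_near. Qed.

Lemma open_approx_cvg z : open_approx n z @[n --> \oo] --> (\1_G z : R).
Proof.
have [Gz|nGz] := pselect (G z); last first.
  rewrite indicE memNset// /open_approx psi0//.
  under eq_fun do rewrite mulr0 min_r//; exact: cvg_cst.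
by rewrite indicE mem_set//; apply: cvg_near_cst; exact: open_approx_near1.
Qed.

Lemma open_approx_le_indic n z : (open_approx n z <= \1_G z)%R.
Proof.
have [Gz|nGz] := pselect (G z); first by rewrite indicE mem_set// open_approx_le1.
by rewrite indicE memNset// /open_approx psi0// mulr0 min_r.
Qed.

End open_approximation.

(** * Joint measurability of the transition measures in time and space *)

Section time_measurability.
Context {R : realType} (E : pmetricType R) (X : hunt_process E).
Let Ed := cemetery_ext E.
Local Notation pth t := (Defs.path t : sample X -> borel Ed).

(** [oapp f 0] need not be continuous at the cemetery, as [f] need not vanish at infinity. A path
    dead at time [s] stays dead, so the limit there is that of a constant. *)
Lemma path_right_continuous_oapp (f : E -> R) (w : sample X) (s : R) :
  continuous f -> (0 <= s)%R ->
  oapp f 0%R (pth r w) @[r --> s^'+] --> oapp f 0%R (pth s w).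
Proof.
move=> cf s0; have := @path_right_continuous _ _ X w s s0.
case ps : (Defs.path s w) => [y|] pc.
  apply: cvg_comp pc _ => A /= fA; exact: (cf y A fA).
apply: cvg_near_cst; near=> r.
have sr : (s <= r)%R by near: r; exact: nbhs_right_ge.
suff -> : pth r w = None by [].
apply: path_absorbed; apply: (@le_trans _ _ s%:E); rewrite ?lee_fin//.
by apply: ereal_inf_lbound; exists s.
Unshelve. all: by end_near. Qed.

Lemma nonneg_borel_continuous (f : E -> R) : continuous f ->
  (forall x, 0 <= f x)%R -> nonneg_borel (EFin \o f).
Proof.
move=> cf f0; split=> [|x]; last by rewrite lee_fin.
apply/measurable_EFinP.
apply: (@measurability _ _ (borel E) _ setT f _ (RGenOpens.measurableE R)).
move=> _ [_ [a [b ->] <-]]; rewrite setTI; apply: open_borel.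
by move/continuousP : cf; apply; exact: interval_open.
Qed.

Lemma transition_right_continuous (f : E -> R) (x : E) (u : nat -> R) (s : R) :
  continuous f -> (forall x, 0 <= f x <= 1)%R -> (0 <= s)%R ->
  (forall n, s < u n)%R -> u @ \oo --> s ->
  \int[transition X (u n) x]_y (f y)%:E @[n --> \oo] -->
  \int[transition X s x]_y (f y)%:E.
Proof.
move=> cf f01 s0 su us.
have f0 y : (0 <= f y)%R by case/andP: (f01 y).
have nf := nonneg_borel_continuous cf f0.
have u0 n : (0 <= u n)%R by apply: le_trans s0 (ltW (su n)).
rewrite (integral_transition X x s0 nf).
under eq_fun do rewrite (integral_transition X x (u0 _) nf).
apply: (@dominated_cvg _ _ _ _ setT _ _ _ (cst 1)) => //.
- move=> n; exact: measurableT_comp (measurable_oapp nf.1) (path_measurable (u0 n)).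
- move=> w _.
  have oE z : oapp (EFin \o f) 0 z = (oapp f 0%R z)%:E by case: z.
  rewrite oE; under eq_fun do rewrite oE.
  apply: cvg_EFin; first exact: nearW.
  exact: cvg_comp (cvgn_at_right su us)
    (path_right_continuous_oapp (w:=w) cf s0).
- exact: finite_measure_integrable_cst.
- move=> n w _; case: (Defs.path (u n) w) => [y|] /=; last by rewrite normr0.
  by rewrite ger0_norm// lee_fin; case/andP: (f01 y).
Qed.


Lemma measurable_transition2_continuous (f : E -> R) :
  continuous f -> (forall x, 0 <= f x <= 1)%R ->
  measurable_fun [set: R * borel E]
    (fun p : R * borel E => \int[transition X p.1 p.2]_y (f y)%:E).
Proof.
move=> cf f01.
have f0 y : (0 <= f y)%R by case/andP: (f01 y).
have nf := nonneg_borel_continuous cf f0.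
(* Times are rounded strictly upwards to the grid of mesh 1/(k+1), so that they converge from the
   right, where continuity is available. *)
pose r k (s : R) : R := ((Num.truncn (k.+1%:R * Num.max 0 s)).+1%:R / k.+1%:R)%R.
have k0 k : (0 < k.+1%:R :> R)%R by rewrite ltr0n.
have m0 (s : R) : (0 <= Num.max 0 s)%R by rewrite le_max lexx.
have r_gt k s : (Num.max 0 s < r k s)%R.
  by rewrite /r ltr_pdivlMr// mulrC; exact: truncnS_gt.
have r_le k s : (r k s <= Num.max 0 s + k.+1%:R^-1)%R.
  rewrite /r ler_pdivrMr// mulrDl mulVf ?gt_eqF// -natr1 lerD2r mulrC.
  by rewrite truncn_le mulr_ge0.
have r_cvg s : r ^~ s @ \oo --> (Num.max 0 s)%R.
  apply: (@squeeze_cvgr _ _ _ _ (cst (Num.max 0 s)%R)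
    (fun k => Num.max 0 s + k.+1%:R^-1)%R).
  - by apply: nearW => k; rewrite (ltW (r_gt _ _)) r_le.
  - exact: cvg_cst.
  - rewrite -[X in _ --> X]addr0; apply: cvgD; first exact: cvg_cst.
    exact: cvg_harmonic.
apply: (@emeasurable_fun_cvg _ _ _ _
  (fun k (p : R * borel E) => \int[transition X (r k p.1) p.2]_y (f y)%:E)).
(* On the slab [A j] the rounded time is constant, and only measurability in the space variable is
   left. *)
- move=> k; pose A j := [set p : R * borel E |
    Num.truncn (k.+1%:R * Num.max 0 p.1)%R = j].
  have -> : [set: R * borel E] = \bigcup_j A j.
    by apply/seteqP; split=> // p _; exists (Num.truncn (k.+1%:R * Num.max 0 p.1)%R).
  apply/measurable_fun_bigcup => j.
    rewrite (_ : A j = (fun p : R * borel E => k.+1%:R * Num.max 0 p.1)%R @^-1` `[j%:R, j.+1%:R[); last first.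
      apply/seteqP; split=> p; rewrite /A/= in_itv/=.
        by move=> <-; apply: truncn_itv; rewrite mulr_ge0.
      exact: truncn_def.
    rewrite -[X in measurable X]setTI; apply: (_ : measurable_fun setT _) => //.
    by apply: measurable_funM => //; apply: measurable_maxr => //.
  apply: (@eq_measurable_fun _ _ _ _ _ (fun p : R * borel E =>
    \int[transition X (j.+1%:R / k.+1%:R) p.2]_y (f y)%:E)).
    by move=> p; rewrite inE /A/= /r => ->.
  apply: measurable_funTS; apply: (measurable_fun_integral_kernel
    (l := fun p : R * borel E => transition X (j.+1%:R / k.+1%:R) p.2)).
  + move=> U mU.
    exact: measurableT_comp (measurable_transition X _ mU) measurable_snd.
  + exact: nf.2.
  + exact: nf.1.
- move=> p _; have -> : \int[transition X p.1 p.2]_y (f y)%:E =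
      \int[transition X (Num.max 0 p.1)%R p.2]_y (f y)%:E.
    apply: eq_measure_integral => A mA _; rewrite /= /transition.
    by rewrite (max_r (m0 p.1)).
  by apply: transition_right_continuous => //; exact: r_cvg.
Qed.

(** Continuous functions increasing to the indicator reach the open sets, which form a pi-system;
    the complement step of Dynkin's argument subtracts from the finite total mass. *)
Lemma measurable_transition2 (A : set (borel E)) : measurable A ->
  measurable_fun [set: R * borel E]
    (fun p : R * borel E => transition X p.1 p.2 A).
Proof.
pose P A := measurable_fun [set: R * borel E]
    (fun p : R * borel E => transition X p.1 p.2 A).
have PG (G : set E) : open G -> P G.
  move=> oG; have c n : continuous (open_approx G n) by exact: open_approx_continuous.
  have b n z : (0 <= open_approx G n z <= 1)%R.
    by rewrite open_approx_ge0 open_approx_le1.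
  have nb n := nonneg_borel_continuous (c n) (fun z => open_approx_ge0 G n z).
  apply: (@emeasurable_fun_cvg _ _ _ _
    (fun n (p : R * borel E) => \int[transition X p.1 p.2]_y (open_approx G n y)%:E)).
    by move=> n; exact: measurable_transition2_continuous.
  move=> p _; rewrite [X in _ --> X](_ : _ =
    \int[transition X p.1 p.2]_z limn (fun n => (open_approx G n z)%:E)); last first.
    rewrite -[G in LHS]setIT -integral_indic//; last exact: open_borel.
    apply: eq_integral => z _; apply/esym/cvg_lim => //.
    apply: cvg_EFin; first exact: nearW.
    exact: open_approx_cvg.
  apply: cvg_monotone_convergence => //.
  - by move=> n; exact: (nb n).1.
  - by move=> n z _; rewrite lee_fin open_approx_ge0.
  - by move=> z _ n q nq; rewrite lee_fin open_approx_nondecreasing.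
move=> mA; apply: (@dynkin_induction _ (borel E) (@open E) P) => //.
- by move=> U V; exact: openI.
- by apply: PG; exact: openT.
- move=> S mS PS.
  rewrite /P (_ : (fun _ => _) = (fun p : R * borel E => transition X p.1 p.2 setT -
    transition X p.1 p.2 S)).
    by apply: emeasurable_funB => //; apply: PG; exact: openT.
  apply/funext => p; rewrite -setTD measureD//; last first.
    by rewrite -ge0_fin_numE//; apply: fin_num_measure.
  by rewrite setTI.
- move=> F mF tF PF; rewrite /P (_ : (fun _ => _) = (fun p : R * borel E =>
    \sum_(0 <= i <oo | i \in setT) transition X p.1 p.2 (F i))); last first.
    by apply/funext => p; rewrite measure_bigcup.
  by apply: ge0_emeasurable_sum => // *; exact: PF.
Qed.

End time_measurability.

(** * The Markov property and the discounted semigroup *)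

Section markov_property.
Context {R : realType} (E : pmetricType R) (X : hunt_process E).
Let Ed := cemetery_ext E.
Local Notation pth t := (Defs.path t : sample X -> borel Ed).

Lemma transition_time0 (x : E) (A : set (borel E)) : measurable A ->
  transition X 0 x A = \d_(x : borel E) A.
Proof.
move=> mA; rewrite /transition max_r// diracE.
have mp : measurable (pth 0%R @^-1` (Some @` A)).
  by have := measurable_path_preimage X 0%R mA; rewrite max_r.
have [N [mN N0 NP]] := path_normal X (Some x).
have [Ax|nAx] := boolP (x \in A); last first.
  apply: measure_negligible => //; exists N; split=> // w /= -[y Ay yw].
  apply: NP => /= pw; move: nAx; rewrite notin_setE; apply.
  by move: yw; rewrite pw => -[<-].
rewrite /= -[RHS](@probability_setT _ _ _ (law X (Some x))).
apply/eqP; rewrite eq_le probability_setT probability_le1//=.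
rewrite -(@probability_setT _ _ _ (law X (Some x))).
apply: (@le_trans _ _ (law X (Some x) (~` N))).
  by rewrite probability_setC// N0 sube0 probability_setT.
apply: le_measure; rewrite ?inE//; first exact: measurableC.
move=> w nNw /=; exists x; first exact: set_mem.
by apply: contrapT => pw; apply: nNw; apply: NP => /= e; apply: pw; rewrite e.
Qed.

Lemma law_cemetery (s : R) (A : set (borel E)) : (0 <= s)%R -> measurable A ->
  law X None (pth s @^-1` (Some @` A)) = 0.
Proof.
move=> s0 mA.
have mp : measurable (pth s @^-1` (Some @` A)).
  by have := measurable_path_preimage X s mA; rewrite max_r.
have [N [mN N0 NP]] := path_normal X None.
apply: measure_negligible => //; exists N; split=> // w /= -[y Ay yw].
apply: NP => /= pw; move: yw.
suff -> : pth s w = None by [].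
apply: path_absorbed; apply: (@le_trans _ _ 0%:E); rewrite ?lee_fin//.
by apply: ereal_inf_lbound; exists 0%R.
Qed.

(** The strong Markov identity at the constant time [t], integrated over the whole sample space.
    Paths already dead at [t] contribute 0 by [law_cemetery]. *)
Lemma transition_add (t s : R) (x : E) (A : set (borel E)) :
  (0 <= t)%R -> (0 <= s)%R -> measurable A ->
  transition X (t + s) x A = \int[transition X t x]_y transition X s y A.
Proof.
move=> t0 s0 mA.
have [M [[sM Mm _ _] _ smp _]] := strong_markov_quasi_left_continuous X.
have st : stopping_time M (fun=> t%:E).
  split=> [w|r r0]; first by rewrite lee_fin.
  have [M0 MC _] := sM r r0.
  have [tr|tr] := leP t r.
    rewrite (_ : [set _ | _] = setT); last first.
      by apply/seteqP; split=> // w _ /=; rewrite lee_fin.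
    by rewrite -setC0 -setTD; exact: MC.
  rewrite (_ : [set _ | _] = set0)//; apply/seteqP; split=> // w /=.
  by rewrite lee_fin leNgt tr.
have sst : stopped_sigma_algebra M (fun=> t%:E) setT.
  by split=> [|r r0]; [exact: measurableT|rewrite setTI; exact: st.2].
have := smp (Some x) _ _ s _ st sst s0 (measurable_image_some mA).
rewrite (_ : [set w | _ /\ _] = pth (t + s)%R @^-1` (Some @` A)); last first.
  by apply/seteqP; split=> w /=; [case|split; rewrite ?ltry].
rewrite (_ : [set w | _] = setT); last first.
  by apply/seteqP; split=> // w _ /=; rewrite ltry.
rewrite !setTI /=.
rewrite {1}/transition max_r ?addr_ge0// => ->.
rewrite integral_transition//; last first.
  by split=> [|y]; [exact: measurable_transition|exact: measure_ge0].
apply: eq_integral => w _; case: (Defs.path t w) => [y|] /=.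
  by rewrite /transition max_r.
exact: law_cemetery.
Qed.

Lemma integral_transition0 (f : E -> \bar R) (x : E) : nonneg_borel f ->
  \int[transition X 0 x]_y f y = f x.
Proof.
move=> [mf f0]; rewrite (eq_measure_integral (dirac (x : borel E))); last first.
  by move=> A mA _; exact: transition_time0.
by rewrite integral_dirac// diracT mul1e.
Qed.

(** The mass lies between 1 and the integral of a continuous minorant of the indicator of [G] that
    equals 1 at [x]; by right continuity at time 0 that integral tends to 1. *)
Lemma transition_open_cvg1 (G : set E) (x : E) (u : nat -> R) : open G -> G x ->
  (forall n, 0 < u n)%R -> u @ \oo --> 0%R ->
  transition X (u n) x G @[n --> \oo] --> 1.
Proof.
move=> oG Gx u0 uc.
have mG : measurable (G : set (borel E)) := open_borel oG.
have [k _ /(_ k (leqnn k)) fk] := open_approx_near1 oG Gx.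
have nf n : nonneg_borel (EFin \o open_approx G n).
  apply: nonneg_borel_continuous; first exact: open_approx_continuous.
  by move=> y; exact: open_approx_ge0.
apply: (@squeeze_cvge _ _ _ _ (fun n => \int[transition X (u n) x]_y (open_approx G k y)%:E)
   _ (cst 1)).
- apply: nearW => n; apply/andP; split; last first.
    apply: le_trans (transition_le1 X (u n) x).
    by apply: le_measure => //; rewrite inE.
  rewrite -[G in leRHS]setIT -integral_indic//; apply: ge0_le_integral => //.
  + by move=> y _; rewrite lee_fin open_approx_ge0.
  + exact: (nf k).1.
  + by apply/measurable_EFinP; exact: measurable_indic.
  + by move=> y _; rewrite lee_fin open_approx_le_indic.
- have -> : 1 = \int[transition X 0 x]_y (open_approx G k y)%:E.
    by rewrite (integral_transition0 x (nf k)) /= fk.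
  apply: transition_right_continuous => //; first exact: open_approx_continuous.
  by move=> y; rewrite open_approx_ge0 open_approx_le1.
- exact: cvg_cst.
Qed.


(** The factor e^(-at) is part of the measure, so that the discounted semigroup is a plain integral,
    to which composition of kernels and Tonelli apply directly. *)
Definition discounted (a t : R) (x : E) : set (borel E) -> \bar R :=
  mscale (NngNum (expR_ge0 (- (a * t)))) (transition X t x).

HB.instance Definition _ a t x := FiniteMeasure.copy (discounted a t x)
  (mscale (NngNum (expR_ge0 (- (a * t)))) (transition X t x)).

Lemma discountedE a t x A :
  discounted a t x A = (expR (- (a * t)))%:E * transition X t x A.
Proof. by []. Qed.

Lemma integral_discounted a t x (f : E -> \bar R) : nonneg_borel f ->
  \int[discounted a t x]_y f y =
  (expR (- (a * t)))%:E * \int[transition X t x]_y f y.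
Proof. by move=> [mf f0]; rewrite ge0_integral_mscale. Qed.

Lemma measurable_discounted a t (A : set (borel E)) : measurable A ->
  measurable_fun [set: borel E] ((fun x => discounted a t x A) : borel E -> \bar R).
Proof.
by move=> mA; apply: measurable_funeM; exact: measurable_transition.
Qed.

Lemma measurable_discounted2 a (A : set (borel E)) : measurable A ->
  measurable_fun [set: R * borel E] (fun p : R * borel E => discounted a p.1 p.2 A).
Proof.
move=> mA; apply: emeasurable_funM; last exact: measurable_transition2.
apply/measurable_EFinP; apply: measurableT_comp => //.
by apply: measurableT_comp => //; exact: measurable_funM.
Qed.

Lemma discounted_setT_le a t x : discounted a t x setT <= (expR (- (a * t)))%:E.
Proof.
rewrite discountedE -[leRHS]mule1; apply: lee_wpmul2l (transition_le1 _ _ _).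
by rewrite lee_fin expR_ge0.
Qed.

Let discounted_kernel a t : borel E -> {measure set (borel E) -> \bar R} :=
  discounted a t.

HB.instance Definition _ a t := @isKernel.Build _ _ (borel E) (borel E) R
  (discounted_kernel a t) (@measurable_discounted a t).

Let discounted_kernel_uub a t : measure_fam_uub (discounted_kernel a t).
Proof.
exists (expR (- (a * t)) + 1)%R => x.
by rewrite (le_lt_trans (discounted_setT_le _ _ _))// lte_fin ltrDl.
Qed.

HB.instance Definition _ a t := @Kernel_isFinite.Build _ _ _ _ R
  (discounted_kernel a t) (discounted_kernel_uub a t).

(** [kcomp] expects a second kernel that sees both the starting point and the intermediate point;
    this one ignores the first coordinate. *)
Let discounted_snd a t : borel E * borel E -> {measure set (borel E) -> \bar R} :=
  fun p => discounted a t p.2.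

Let measurable_discounted_snd a t U : measurable U ->
  measurable_fun [set: borel E * borel E] (discounted_snd a t ^~ U).
Proof.
by move=> mU; exact: measurableT_comp (measurable_discounted _ _ mU) measurable_snd.
Qed.

HB.instance Definition _ a t := @isKernel.Build _ _ _ _ R
  (discounted_snd a t) (@measurable_discounted_snd a t).

Let discounted_snd_uub a t : measure_fam_uub (discounted_snd a t).
Proof.
exists (expR (- (a * t)) + 1)%R => x.
by rewrite (le_lt_trans (discounted_setT_le _ _ _))// lte_fin ltrDl.
Qed.

HB.instance Definition _ a t := @Kernel_isFinite.Build _ _ _ _ R
  (discounted_snd a t) (discounted_snd_uub a t).

Definition dsg a t (f : E -> \bar R) (x : E) : \bar R := \int[discounted a t x]_y f y.

Lemma discounted_semigroupE a t x (f : E -> \bar R) : (0 <= t)%R ->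
  nonneg_borel f ->
  (expR (- (a * t)))%:E * semigroup X t f x = dsg a t f x.
Proof. by move=> t0 nf; rewrite /dsg integral_discounted// semigroupE. Qed.

Lemma discounted_add a t s x A : (0 <= t)%R -> (0 <= s)%R -> measurable A ->
  discounted a (t + s) x A = \int[discounted a t x]_y discounted a s y A.
Proof.
move=> t0 s0 mA; rewrite discountedE transition_add//.
rewrite integral_discounted; last first.
  by split=> [|y]; [exact: measurable_discounted|exact: measure_ge0].
rewrite [X in _ = _ * X](_ : _ = (expR (- (a * s)))%:E * \int[transition X t x]_y transition X s y A); last first.
  rewrite -ge0_integralZl//; first exact: measurable_transition.
by rewrite muleA -EFinM -expRD mulrDr opprD.
Qed.

Lemma dsg_add a t s (f : E -> \bar R) x : (0 <= t)%R -> (0 <= s)%R ->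
  nonneg_borel f -> dsg a (t + s) f x = dsg a t (dsg a s f) x.
Proof.
move=> t0 s0 [mf f0].
rewrite /dsg (eq_measure_integral (kcomp (discounted_kernel a t) (discounted_snd a s) x)).
  by rewrite integral_kcomp.
by move=> A mA _; exact: discounted_add.
Qed.

Lemma dsg_time0 a (f : E -> \bar R) x : nonneg_borel f -> dsg a 0 f x = f x.
Proof.
by move=> nf; rewrite /dsg integral_discounted// mulr0 oppr0 expR0 mul1e integral_transition0.
Qed.

Lemma nonneg_borel_dsg a t (f : E -> \bar R) : nonneg_borel f ->
  nonneg_borel (dsg a t f).
Proof.
move=> [mf f0]; split=> [|x]; last by apply: integral_ge0.
apply: (measurable_fun_integral_kernel (l := discounted_kernel a t)) => //.
by move=> U mU; exact: measurable_discounted.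
Qed.

Lemma measurable_dsg2 a (f : E -> \bar R) : nonneg_borel f ->
  measurable_fun [set: R * borel E] (fun p : R * borel E => dsg a p.1 f p.2).
Proof.
move=> [mf f0].
apply: (measurable_fun_integral_kernel (l := fun p : R * borel E => discounted a p.1 p.2)) => //.
by move=> U mU; exact: measurable_discounted2.
Qed.

Lemma measurable_dsg_time a (f : E -> \bar R) x : nonneg_borel f ->
  measurable_fun [set: R] (fun t : R => dsg a t f x).
Proof.
by move=> nf; exact: measurableT_comp (measurable_dsg2 a nf) (pair2_measurable (x : borel E)).
Qed.

Lemma dsg_le a t (f g : E -> \bar R) x : nonneg_borel f -> nonneg_borel g ->
  (forall y, f y <= g y) -> dsg a t f x <= dsg a t g x.
Proof. by move=> [mf f0] [mg g0] fg; apply: ge0_le_integral. Qed.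

Lemma discounted_open_cvg1 a (G : set E) (x : E) (u : nat -> R) : open G -> G x ->
  (forall n, 0 < u n)%R -> u @ \oo --> 0%R ->
  discounted a (u n) x G @[n --> \oo] --> 1.
Proof.
move=> oG Gx u0 uc; rewrite -[1]mule1; apply: cvgeM => //.
  apply: cvg_EFin; first exact: nearW.
  rewrite /comp/= -(@expR0 R); apply: continuous_cvg; first exact: continuous_expR.
  rewrite -[X in _ --> X]oppr0; apply: cvgN; rewrite -[X in _ --> X](mulr0 a).
  by apply: cvgM => //; exact: cvg_cst.
exact: transition_open_cvg1.
Qed.

Lemma resolventE a (f : E -> \bar R) x : nonneg_borel f ->
  resolvent X a f x = \int[lebesgue_measure]_(t in `[0%R, +oo[) dsg a t f x.
Proof.
move=> nf; apply: eq_integral => t; rewrite inE/= in_itv/= andbT => t0.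
exact: discounted_semigroupE.
Qed.

End markov_property.

(** * Integration in time: translation and Tonelli on a subset *)

Lemma integral_itvcy_shift (R : realType) (f : R -> \bar R) (t : R) :
  measurable_fun setT f -> (forall s, 0 <= f s) ->
  \int[lebesgue_measure]_(s in `[t, +oo[) f s =
  \int[lebesgue_measure]_(s in `[0%R, +oo[) f (t + s)%R.
Proof.
move=> mf f0.
pose sh : R -> measurableTypeR R := +%R t.
have msh : measurable_fun setT sh by apply: measurable_funD.
have lE A : measurable A -> pushforward lebesgue_measure sh A = lebesgue_measure A.
  move=> mA; apply/esym/lebesgue_measure_unique => //= _ [[a b]] _ <-.
  rewrite /pushforward (_ : sh @^-1` _ = `](a - t)%R, (b - t)%R]%classic).
    rewrite !lebesgue_measure_itv/= !lte_fin ltrD2r.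
    by case: ifP => // _; rewrite -!EFinD opprB addrA subrK.
  by apply/seteqP; split=> x; rewrite /sh /= !in_itv/= ltrBlDl lerBrDl.
rewrite [X in _ = \int[_]_(s in X) _](_ : _ = sh @^-1` `[t, +oo[); last first.
  by apply/seteqP; split=> x; rewrite /sh /= !in_itv/= !andbT lerDl.
have H := @ge0_integral_pushforward _ _ (measurableTypeR R) (measurableTypeR R) R sh msh
  lebesgue_measure `[t, +oo[%classic f.
rewrite -[RHS]H//; last by apply: measurable_funS mf.
by apply: eq_measure_integral => //= A mA _; exact/esym/lE.
Qed.

Section fubini_domain.
Context {R : realType} d1 d2 (S : measurableType d1) (T : measurableType d2).
Variables (mu : {sigma_finite_measure set S -> \bar R}) (D : set S).
Hypothesis mD : measurable D.
Variable F : S * T -> \bar R.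
Hypothesis (mF : measurable_fun setT F) (F0 : forall p, 0 <= F p).

(** Extension by 0 off [D] reduces both statements to Tonelli on the full product. *)
Let G := F \_ (fst @^-1` D).

Let mG : measurable_fun setT G.
Proof.
apply: (measurable_restrictT _ _).1 => //.
  by rewrite -[X in measurable X]setTI; exact: measurable_fst.
exact: measurable_funS mF.
Qed.

Let G0 p : 0 <= G p. Proof. exact: erestrict_ge0. Qed.

Let GE x : \int[mu]_(s in D) F (s, x) = \int[mu]_s G (s, x).
Proof. by rewrite integral_mkcond; apply: eq_integral => s _. Qed.

Lemma measurable_fun_integral_domain :
  measurable_fun setT (fun x => \int[mu]_(s in D) F (s, x)).
Proof.
under eq_fun do rewrite GE; exact: measurable_fun_fubini_tonelli_G.
Qed.

Lemma fubini_tonelli_domain (nu : {sigma_finite_measure set T -> \bar R}) :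
  \int[nu]_x \int[mu]_(s in D) F (s, x) = \int[mu]_(s in D) \int[nu]_x F (s, x).
Proof.
have GsE s x : G (s, x) = if s \in D then F (s, x) else 0.
  by rewrite /G patchE; congr (if _ then _ else _).
transitivity (\int[mu]_s \int[nu]_x G (s, x)).
  rewrite (@fubini_tonelli _ _ _ _ _ mu nu G mG G0).
  by apply: eq_integral => x _; exact: GE.
rewrite [RHS]integral_mkcond; apply: eq_integral => s _; rewrite patchE.
case: ifPn => sD; first by apply: eq_integral => x _; rewrite GsE sD.
by apply: integral0_eq => x _; rewrite GsE (negbTE sD).
Qed.

End fubini_domain.

(** * Potentials and occupation integrals *)

Section time_integrals.
Context {R : realType} (E : pmetricType R) (X : hunt_process E) (a : R).
Local Notation leb := (@lebesgue_measure R).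
Local Notation P t f := (dsg X a t f).

Definition time_integral (D : set R) (f : E -> \bar R) (x : E) : \bar R :=
  \int[leb]_(s in D) P s f x.

Definition potential_op := time_integral `[0%R, +oo[.
Definition occupation (t : R) := time_integral `[0%R, t[.

Lemma nonneg_borel_time_integral D f : measurable D -> nonneg_borel f ->
  nonneg_borel (time_integral D f).
Proof.
move=> mD nf; split=> [|x]; last first.
  by apply: integral_ge0 => s _; exact: (nonneg_borel_dsg X a s nf).2.
apply: (@measurable_fun_integral_domain R _ _ _ _ leb D mD
  (fun p : R * borel E => P p.1 f p.2)); first exact: measurable_dsg2.
by move=> p; exact: (nonneg_borel_dsg X a _ nf).2.
Qed.

Lemma resolvent_potential_op f x : nonneg_borel f ->
  resolvent X a f x = potential_op f x.
Proof. exact: resolventE. Qed.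

Lemma potential_op_split t f x : (0 <= t)%R -> nonneg_borel f ->
  potential_op f x = occupation t f x + time_integral `[t, +oo[ f x.
Proof.
move=> t0 nf; rewrite /potential_op /occupation /time_integral.
have tE : `[0%R, +oo[%classic = `[0%R, t[%classic `|` `[t, +oo[%classic :> set R.
  apply/seteqP; split=> s /=; rewrite !in_itv/= !andbT.
    by move=> s0; case: (ltP s t) => st; [left; rewrite s0|right].
  by case=> [/andP[]//|]; exact: le_trans.
rewrite tE ge0_integral_setU//.
- by apply: measurable_funTS; exact: measurable_dsg_time.
- by move=> s _; exact: (nonneg_borel_dsg X a _ nf).2.
- rewrite disj_set2E; apply/eqP/seteqP; split=> // s [] /=; rewrite !in_itv/= andbT.
  by move=> /andP[_ st] ts; move: (lt_le_trans st ts); rewrite ltxx.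
Qed.

(** The tail integral has two readings, U P_t f here and P_t U f in [dsg_potential_op]. The first
    serves under duality, where P_t falls on the test function; the second compares a potential with
    its image under P_t. *)
Lemma potential_op_dsg t f x : (0 <= t)%R -> nonneg_borel f ->
  time_integral `[t, +oo[ f x = potential_op (P t f) x.
Proof.
move=> t0 nf; rewrite /time_integral (integral_itvcy_shift (f := fun s => P s f x)).
- apply: eq_integral => s; rewrite inE/= in_itv/= andbT => s0.
  by rewrite addrC dsg_add.
- exact: measurable_dsg_time.
- by move=> s; exact: (nonneg_borel_dsg X a _ nf).2.
Qed.

Lemma dsg_potential_op t f x : (0 <= t)%R -> nonneg_borel f ->
  time_integral `[t, +oo[ f x = P t (potential_op f) x.
Proof.
move=> t0 nf; rewrite /time_integral (integral_itvcy_shift (f := fun s => P s f x)).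
- have F0 (p : R * borel E) : 0 <= P p.1 f p.2.
    exact: (nonneg_borel_dsg X a _ nf).2.
  have H := @fubini_tonelli_domain R _ _ _ (borel E) leb `[0%R, +oo[%classic
    (measurable_itv _) _ (measurable_dsg2 X a nf) F0 (discounted X a t x).
  transitivity (\int[leb]_(s in `[0%R, +oo[) P t (P s f) x).
    apply: eq_integral => s; rewrite inE/= in_itv/= andbT => s0.
    by rewrite dsg_add.
  exact: esym H.
- exact: measurable_dsg_time.
- by move=> s; exact: (nonneg_borel_dsg X a _ nf).2.
Qed.

End time_integrals.

(** * Short-time behaviour on lower semicontinuous functions *)

Lemma lee_real_below (R : realType) (y z : \bar R) :
  (forall c : R, c%:E < y -> c%:E <= z) -> y <= z.
Proof.
case: y => [r| |] H; last exact: leNye.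
  apply/lee_subgt0Pr => e e0; rewrite -EFinB; apply: H.
  by rewrite lte_fin ltrBlDr ltrDl.
suff -> : z = +oo by [].
by apply/eqyP => c _; apply: H; rewrite ltry.
Qed.

Lemma lte_real_between (R : realType) (c : R) (y : \bar R) : c%:E < y ->
  exists2 d : R, (c < d)%R & d%:E < y.
Proof.
case: y => [r|_|//].
  by rewrite lte_fin => cr; exists ((c + r) / 2)%R; rewrite ?lte_fin ?midf_lt.
by exists (c + 1)%R; rewrite ?ltry// ltrDl.
Qed.

Lemma le_limn_einf (R : realType) (u : (\bar R)^nat) (y : \bar R) :
  (forall c : R, c%:E < y -> \forall n \near \oo, c%:E <= u n) ->
  y <= limn_einf u.
Proof.
move=> H; apply: lee_real_below => c /H [N _ cN].
rewrite limn_einf_lim; apply: lime_ge; first exact: is_cvg_einfs.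
exists N => // n /= Nn; apply: le_ereal_inf_tmp => _ [k /= nk <-].
by apply: cN => /=; exact: leq_trans Nn nk.
Qed.

Lemma cvg_invSn (R : realType) : (n.+1%:R^-1 : R)%R @[n --> \oo] --> (0 : R)%R.
Proof. exact: cvg_harmonic. Qed.

Section short_time.
Context {R : realType} (E : pmetricType R) (X : hunt_process E) (a : R).
Local Notation leb := (@lebesgue_measure R).
Local Notation P t f := (dsg X a t f).

(** For d strictly between c and g x, the open set where g > d receives mass tending to 1. So P_s g
    x, which is at least d times that mass, is at least c for small s. *)
Lemma dsg_lsc_near (g : E -> \bar R) x (c : R) : nonneg_borel g ->
  lower_semicontinuous g -> c%:E < g x -> \forall s \near 0^'+, c%:E <= P s g x.
Proof.
move=> ng lg cg.
have Pg0 s : 0 <= P s g x := (nonneg_borel_dsg X a s ng).2 x.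
have [c0|c0] := ltP c 0%R.
  by apply: nearW => s; apply: le_trans (Pg0 s); rewrite lee_fin ltW.
have [d cd dg] := lte_real_between cg.
pose G : set E := [set y | d%:E < g y].
have oG : open G by move/lower_semicontinuousP : lg; exact.
have d0 : (0 < d)%R by exact: le_lt_trans c0 cd.
have fG s : discounted X a s x G \is a fin_num.
  by apply: fin_num_measure; exact: open_borel.
have : fine (discounted X a s x G) @[s --> 0^'+] --> (1 : R)%R.
  apply/cvg_at_rightP => u [u0 uc]; apply/fine_cvg.
  exact: discounted_open_cvg1.
move=> /(cvgr_gt _)/(_ (c / d)%R); rewrite ltr_pdivrMr// mul1r => /(_ cd).
apply: filterS => s; rewrite -lte_fin fineK// => cdG.
apply: (@le_trans _ _ (d%:E * discounted X a s x G)).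
  by rewrite muleC -lee_pdivrMr// -EFinM ltW.
rewrite -[G in leLHS]setIT -integral_indic//; last exact: open_borel.
rewrite -ge0_integralZl//; last 2 first.
- by apply/measurable_EFinP; apply: measurable_indic; exact: open_borel.
- by rewrite lee_fin ltW.
apply: ge0_le_integral => //.
- by move=> y _; rewrite mule_ge0// lee_fin// ltW.
- apply: measurable_funeM; apply/measurable_EFinP; apply: measurable_indic.
  exact: open_borel.
- exact: ng.1.
- move=> y _; have [Gy|nGy] := pselect (G y).
    by rewrite indicE mem_set// mule1 ltW.
  by rewrite indicE memNset// mule0; exact: ng.2.
Qed.

Lemma occupation_lsc_near (g : E -> \bar R) x (c : R) : nonneg_borel g ->
  lower_semicontinuous g -> c%:E < g x ->
  \forall n \near \oo, c%:E <= n.+1%:R%:E * occupation X a n.+1%:R^-1 g x.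
Proof.
move=> ng lg cg.
have Pg0 s : 0 <= P s g x := (nonneg_borel_dsg X a s ng).2 x.
have O0 t : 0 <= occupation X a t g x by apply: integral_ge0 => s _.
have [c0|c0] := ltP c 0%R.
  apply: nearW => n; apply: (@le_trans _ _ 0); first by rewrite lee_fin ltW.
  by rewrite mule_ge0.
have [e /= e0 eP] := dsg_lsc_near ng lg cg.
near=> n; rewrite -lee_pdivrMl//.
have ne : (n.+1%:R^-1 < e)%R.
  near: n; apply: (cvgr_lt (0 : R)%R) => //; exact: cvg_invSn.
(* The interval is opened at 0 because [eP] holds for positive times only. *)
have -> : (n.+1%:R^-1)%:E * c%:E = \int[leb]_(s in `]0%R, (n.+1%:R^-1)%R[) c%:E.
  have lE : leb `]0%R, (n.+1%:R^-1)%R[%classic = (n.+1%:R^-1)%:E.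
    by rewrite lebesgue_measure_itv/= lte_fin invr_gt0 ltr0n oppr0 adde0.
  by rewrite integral_cst// muleC; congr (_ * _); rewrite -lE.
rewrite /occupation /time_integral.
apply: (@le_trans _ _ (\int[leb]_(s in `]0%R, (n.+1%:R^-1)%R[) P s g x)).
  apply: ge0_le_integral => //.
  - by apply: measurable_funTS; exact: measurable_dsg_time.
  - move=> s; rewrite /= in_itv/= => /andP[s0 sn]; apply: eP => //=.
    by rewrite sub0r normrN gtr0_norm// (lt_trans sn).
apply: ge0_subset_integral => //.
  by apply: measurable_funTS; exact: measurable_dsg_time.
by move=> s /=; rewrite !in_itv/= => /andP[/ltW -> ->].
Unshelve. all: by end_near. Qed.

(* Fatou along the occupation averages n * \int_0^(1/n) P_s g ds, whose lower
   limit dominates a lower semicontinuous g. *)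
Lemma integral_le_occupation (nu : {measure set (borel E) -> \bar R})
    (W : E -> R) (g : E -> \bar R) (b : nat -> \bar R) (l : \bar R) :
  measurable_fun [set: borel E] (W : borel E -> R) -> (forall x, 0 <= W x)%R ->
  nonneg_borel g -> lower_semicontinuous g ->
  (forall n, \int[nu]_x ((W x)%:E *
    (n.+1%:R%:E * occupation X a n.+1%:R^-1 g x)) <= b n) ->
  b @ \oo --> l -> \int[nu]_x ((W x)%:E * g x) <= l.
Proof.
move=> mW W0 ng lg gb bl.
pose F n x := (W x)%:E * (n.+1%:R%:E * occupation X a n.+1%:R^-1 g x).
have nO t : nonneg_borel (occupation X a t g) by apply: nonneg_borel_time_integral.
have mF n : measurable_fun [set: borel E] (F n : borel E -> \bar R).
  apply: emeasurable_funM; first exact/measurable_EFinP.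
  by apply: measurable_funeM; exact: (nO _).1.
have F0 n x : 0 <= F n x.
  by rewrite !mule_ge0// ?lee_fin//; exact: (nO _).2.
have mWg : measurable_fun [set: borel E] (fun x : borel E => (W x)%:E * g x).
  by apply: emeasurable_funM ng.1; exact/measurable_EFinP.
apply: (@le_trans _ _ (\int[nu]_x limn_einf (F ^~ x))).
  apply: ge0_le_integral => //.
  - by move=> x _; rewrite mule_ge0// ?lee_fin//; exact: ng.2.
  - apply: (@emeasurable_fun_cvg _ (borel E) R setT (fun n x => einfs (F ^~ x) n)
      (fun x => limn_einf (F ^~ x))).
      by move=> n; exact: measurable_fun_einfs.
    by move=> x _; rewrite limn_einf_lim; exact: is_cvg_einfs.
  - move=> x _; have := W0 x; rewrite le_eqVlt => /orP[/eqP Wx|Wx].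
      rewrite -Wx mul0e; apply: le_limn_einf => c c0.
      by apply: nearW => n; apply: le_trans (ltW c0) (F0 _ _).
    apply: le_limn_einf => c; rewrite -lte_pdivrMl// -EFinM.
    move=> /(occupation_lsc_near ng lg); apply: filterS => n.
    by rewrite EFinM lee_pdivrMl.
apply: le_trans (fatou nu measurableT mF (fun n x _ => F0 n x)) _.
have -> : l = limn_einf b by have [->] := cvg_limn_einf_sup bl.
rewrite !limn_einf_lim; apply: lee_lim; [exact: is_cvg_einfs..|].
apply: nearW => n; apply: le_ereal_inf_tmp => _ [k /= nk <-].
by apply: le_trans (gb k); apply: ereal_inf_lbound; exists k.
Qed.

End short_time.

(** * Bounds on potentials, and excessive functions *)

Lemma integral_expR (R : realType) (a : R) : (0 < a)%R ->
  \int[lebesgue_measure]_(s in `[0%R, +oo[) (expR (- (a * s)))%:E = (a^-1)%:E.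
Proof.
move=> a0; have := integral_exponential_pdf a0.
rewrite (_ : \int[_]_x _ = a%:E * \int[lebesgue_measure]_(s in `[0%R, +oo[) (expR (- (a * s)))%:E).
  move=> H; rewrite -[LHS]mul1e -(mulVf (x := a)) ?gt_eqF// EFinM -muleA H mule1.
  by [].
rewrite -ge0_integralZl//; last 2 first.
- apply: measurable_funTS; apply/measurable_EFinP; apply: measurableT_comp => //.
  by apply: measurableT_comp => //; exact: measurable_funM.
- by rewrite lee_fin ltW.
rewrite [RHS]integral_mkcond; apply: eq_integral => s _.
rewrite patchE /exponential_pdf patchE; case: ifPn => // _.
by rewrite -EFinM mulNr.
Qed.

Lemma integral_scaled_expR (R : realType) (a C : R) : (0 < a)%R -> (0 <= C)%R ->
  \int[lebesgue_measure]_(s in `[0%R, +oo[) (C * expR (- (a * s)))%:E = (C / a)%:E.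
Proof.
move=> a0 C0; rewrite EFinM -(integral_expR a0) -ge0_integralZl//.
apply: measurable_funTS; apply/measurable_EFinP; apply: measurableT_comp => //.
by apply: measurableT_comp => //; exact: measurable_funM.
Qed.

Section excessive_functions.
Context {R : realType} (E : pmetricType R) (X : hunt_process E) (a : R).
Local Notation leb := (@lebesgue_measure R).
Local Notation P t f := (dsg X a t f).

Lemma dsg_bound t (f : E -> \bar R) (C : R) x : nonneg_borel f ->
  (forall y, f y <= C%:E) -> P t f x <= (C * expR (- (a * t)))%:E.
Proof.
move=> [mf f0] fC; have C0 : 0 <= C%:E by apply: le_trans (f0 x) (fC x).
apply: (@le_trans _ _ (\int[discounted X a t x]_y C%:E)).
  by apply: ge0_le_integral.
rewrite integral_cst// EFinM; apply: lee_wpmul2l => //.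
exact: discounted_setT_le.
Qed.

Lemma integral_cst_co (c t : R) : (0 <= t)%R ->
  \int[leb]_(s in `[0%R, t[) c%:E = (c * t)%:E.
Proof.
move=> t0; have lE : leb `[0%R, t[%classic = t%:E.
  rewrite lebesgue_measure_itv/= lte_fin oppr0 adde0.
  by have [//|t0'] := ltP; congr EFin; apply/eqP; rewrite eq_le t0 t0'.
by rewrite integral_cst// EFinM; congr (_ * _); rewrite -lE.
Qed.

Lemma occupation_le t (f : E -> \bar R) (C : R) x : (0 <= t)%R -> nonneg_borel f ->
  (forall s, (0 <= s < t)%R -> P s f x <= C%:E) -> (0 <= C)%R ->
  occupation X a t f x <= (C * t)%:E.
Proof.
move=> t0 nf fC C0; rewrite -integral_cst_co//; apply: ge0_le_integral => //.
- by move=> s _; exact: (nonneg_borel_dsg X a s nf).2.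
- by apply: measurable_funTS; exact: measurable_dsg_time.
Qed.

Lemma occupation_ge t (f : E -> \bar R) (C : R) x : (0 <= t)%R -> nonneg_borel f ->
  (forall s, (0 <= s < t)%R -> C%:E <= P s f x) -> (0 <= C)%R ->
  (C * t)%:E <= occupation X a t f x.
Proof.
move=> t0 nf fC C0; rewrite -integral_cst_co//; apply: ge0_le_integral => //.
- by apply: measurable_funTS; exact: measurable_dsg_time.
Qed.

Lemma potential_op_bound (f : E -> \bar R) (C : R) x : (0 < a)%R -> nonneg_borel f ->
  (forall y, f y <= C%:E) -> potential_op X a f x <= (C / a)%:E.
Proof.
move=> a0 nf fC; have C0 : 0 <= C%:E by apply: le_trans (nf.2 x) (fC x).
rewrite -integral_scaled_expR//; apply: ge0_le_integral => //.
- by move=> s _; exact: (nonneg_borel_dsg X a s nf).2.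
- by apply: measurable_funTS; exact: measurable_dsg_time.
- apply: measurable_funTS; apply/measurable_EFinP; apply: measurable_funM => //.
  apply: measurableT_comp => //.
  by apply: measurableT_comp => //; exact: measurable_funM.
- by move=> s _; exact: dsg_bound.
Qed.

Lemma potential_op_decomp t (f : E -> \bar R) x : (0 <= t)%R -> nonneg_borel f ->
  potential_op X a f x = occupation X a t f x + P t (potential_op X a f) x.
Proof.
move=> t0 nf; rewrite (potential_op_split X a x t0 nf); congr (_ + _).
exact: dsg_potential_op.
Qed.

Lemma potential_op_decomp_dsg t (f : E -> \bar R) x : (0 <= t)%R -> nonneg_borel f ->
  potential_op X a f x = occupation X a t f x + potential_op X a (P t f) x.
Proof.
move=> t0 nf; rewrite (potential_op_split X a x t0 nf); congr (_ + _).
exact: potential_op_dsg.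
Qed.

(** Convergence is asked along 1/(n+1) only: P_t f x is nonincreasing in t by the second clause, so
    nothing is lost, and monotone convergence takes sequences. *)
Definition seq_excessive (f : E -> \bar R) : Prop :=
  [/\ nonneg_borel f, forall t x, (0 <= t)%R -> P t f x <= f x &
      forall x, P n.+1%:R^-1 f x @[n --> \oo] --> f x].

Lemma excessive_seq_excessive f : excessive X a f -> seq_excessive f.
Proof.
move=> [nf fle fcvg]; split=> // [t x t0|x].
  by rewrite -discounted_semigroupE//; exact: fle.
have n0 n : (0 <= n.+1%:R^-1 :> R)%R by rewrite invr_ge0.
under eq_fun do rewrite -(discounted_semigroupE _ _ _ (n0 _))//.
have u0 : (n.+1%:R^-1 : R)%R @[n --> \oo] --> (0 : R)^'+.
  by apply: cvgn_at_right => [n|]; [rewrite invr_gt0|exact: cvg_invSn].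
exact: cvg_comp u0 (fcvg x).
Qed.

Lemma dsg_antitone f x s t : seq_excessive f -> (0 <= s)%R -> (s <= t)%R ->
  P t f x <= P s f x.
Proof.
move=> [nf fle _] s0 st; rewrite -(subrK s t) addrC dsg_add ?subr_ge0//.
apply: dsg_le => //; first exact: nonneg_borel_dsg.
by move=> y; apply: fle; rewrite subr_ge0.
Qed.

Lemma dsg_seq_nondecreasing f x : seq_excessive f ->
  {homo (fun n => P n.+1%:R^-1 f x) : n p / (n <= p)%N >-> n <= p}.
Proof.
move=> ef n p np; apply: dsg_antitone => //.
by rewrite lef_pV2 ?posrE// ler_nat.
Qed.

Lemma seq_excessive_near f x (c : R) : seq_excessive f -> c%:E < f x ->
  exists2 t : R, (0 < t)%R & c%:E < P t f x.
Proof.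
move=> [_ _ fcvg] cf.
apply: contrapT => H; move: cf; apply/negP; rewrite -leNgt.
rewrite -(cvg_lim _ (fcvg x))//; apply: lime_le.
  by apply/cvg_ex; exists (f x); exact: fcvg.
apply: nearW => n; rewrite leNgt; apply/negP => cn; apply: H.
by exists n.+1%:R^-1%R => //; rewrite invr_gt0.
Qed.

(** Tonelli moves P_t under the integral over [nu], and P_t rho(., y) increases to rho(., y) along
    the times 1/(n+1). The weight is real because multiplication by a finite number preserves
    limits. *)
Lemma seq_excessive_integral (rho : E * E -> \bar R) (w : E -> R)
    (nu : {sigma_finite_measure set (borel E) -> \bar R}) :
  measurable_fun [set: borel E * borel E] (rho : borel E * borel E -> \bar R) ->
  (forall y, seq_excessive (fun x => rho (x, y))) ->
  measurable_fun [set: borel E] (w : borel E -> R) -> (forall y, 0 <= w y)%R ->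
  seq_excessive (fun x => \int[nu]_y (rho (x, y) * (w y)%:E)).
Proof.
move=> mr er mw w0.
have r0 p : 0 <= rho p by case: p => x y; have [[_ +] _ _] := er y; apply.
have mrw : measurable_fun [set: borel E * borel E]
    (fun p : borel E * borel E => rho p * (w p.2)%:E).
  apply: emeasurable_funM => //; apply/measurable_EFinP.
  exact: measurableT_comp mw measurable_snd.
have rw0 (p : borel E * borel E) : 0 <= rho p * (w p.2)%:E.
  by rewrite mule_ge0// lee_fin.
have PE t x : P t (fun x => \int[nu]_y (rho (x, y) * (w y)%:E)) x =
    \int[nu]_y (P t (fun x => rho (x, y)) x * (w y)%:E).
  rewrite /dsg (@fubini_tonelli _ _ _ _ _ (discounted X a t x) nu _ mrw rw0)/=.
  apply: eq_integral => y _; rewrite ge0_integralZr//; last by rewrite lee_fin.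
  exact: measurableT_comp mr (pair2_measurable (y : borel E)).
have mP t x : measurable_fun [set: borel E]
    (fun y : borel E => P t (fun x => rho (x, y)) x).
  exact: (@measurable_fun_fubini_tonelli_G _ _ _ _ _ (discounted X a t x) _ mr r0).
have P0 t x y : 0 <= P t (fun x => rho (x, y)) x by exact: integral_ge0.
have mPw t x : measurable_fun [set: borel E]
    (fun y : borel E => P t (fun x => rho (x, y)) x * (w y)%:E).
  by apply: emeasurable_funM => //; exact/measurable_EFinP.
have mrx x : measurable_fun [set: borel E] (fun y : borel E => rho (x, y) * (w y)%:E).
  exact: measurableT_comp mrw (pair1_measurable (x : borel E)).
split.
- split; first exact: (@measurable_fun_fubini_tonelli_F _ _ _ _ _ nu _ mrw rw0).
  by move=> x; apply: integral_ge0 => y _; exact: (rw0 (x, y)).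
- move=> t x t0; rewrite PE; apply: ge0_le_integral => //.
  + by move=> y _; rewrite mule_ge0// lee_fin.
  + move=> y _; apply: lee_wpmul2r; first by rewrite lee_fin.
    by have [_ + _] := er y; apply.
- move=> x; under eq_fun do rewrite PE.
  have -> : \int[nu]_y (rho (x, y) * (w y)%:E) =
      \int[nu]_y limn (fun n => P n.+1%:R^-1 (fun x => rho (x, y)) x * (w y)%:E).
    apply: eq_integral => y _; apply/esym/cvg_lim => //.
    by apply: cvgeZr => //; have [_ _] := er y; exact.
  apply: cvg_monotone_convergence => //.
  + by move=> n y _; rewrite mule_ge0// lee_fin.
  + move=> y _ n p np; apply: lee_wpmul2r; first by rewrite lee_fin.
    exact: dsg_seq_nondecreasing.
Qed.

(* Two excessive functions with the same (finite) potential coincide: their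
   occupation integrals then agree, and both are recovered as short-time
   averages. *)
Lemma seq_excessive_le f g x : (0 <= a)%R -> seq_excessive f -> seq_excessive g ->
  (forall y, potential_op X a f y = potential_op X a g y) ->
  potential_op X a g x < +oo -> f x <= g x.
Proof.
move=> a0 ef eg fg gx.
have [nf _ _] := ef; have [ng gle _] := eg.
apply: lee_real_below => c cf; rewrite leNgt; apply/negP => gc.
have gc0 : (0 < c)%R by rewrite -lte_fin; exact: le_lt_trans (ng.2 x) gc.
have [t t0 ct] := seq_excessive_near ef cf.
have [d cd dt] := lte_real_between ct.
have og : occupation X a t f x = occupation X a t g x.
  have := potential_op_decomp x (ltW t0) nf.
  rewrite fg (potential_op_decomp x (ltW t0) ng).
  have -> : potential_op X a f = potential_op X a g by exact/funext.
  rewrite (potential_op_decomp x (ltW t0) ng) in gx.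
  have Pg : P t (potential_op X a g) x \is a fin_num.
    rewrite ge0_fin_numE; last first.
      exact: (nonneg_borel_dsg X a t (nonneg_borel_time_integral X a (measurable_itv _) ng)).2.
    apply: le_lt_trans gx; rewrite leeDr//.
    exact: (nonneg_borel_time_integral X a (measurable_itv _) ng).2.
  by move=> H; rewrite -[LHS](addeK _ Pg) -H addeK.
have : (d * t)%:E <= (c * t)%:E.
  apply: (@le_trans _ _ (occupation X a t f x)).
    apply: (occupation_ge (ltW t0) nf) (ltW (lt_trans gc0 cd)).
    move=> s /andP[s0 st]; apply: (le_trans (ltW dt)).
    by apply: dsg_antitone => //; exact: ltW.
  rewrite og; apply: (occupation_le (ltW t0) ng) (ltW gc0).
  move=> s /andP[s0 st]; apply: le_trans (gle s x s0) (ltW gc).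
by rewrite lee_fin ler_pM2r// leNgt cd.
Qed.

End excessive_functions.

(** * Regularity from the strong Feller property *)

Section strong_feller_regularity.
Context {R : realType} (E : pmetricType R) (X : hunt_process E).
Hypothesis sf : strong_feller X.
Local Notation P a t f := (dsg X a t f).

Lemma dsg_continuous a t (f : E -> \bar R) (C : R) : (0 < t)%R ->
  nonneg_borel f -> (forall y, f y <= C%:E) ->
  continuous (fun x => fine (P a t f x)).
Proof.
move=> t0 nf fC.
have ff y : f y = (fine (f y))%:E.
  by rewrite fineK// ge0_fin_numE ?nf.2// (le_lt_trans (fC y))// ltry.
have bf : bounded_borel (fine \o f).
  split; first by apply: measurableT_comp nf.1; exact: fine_measurable.
  exists C => y; rewrite /= ger0_norm; last by rewrite fine_ge0// nf.2.
  by rewrite -lee_fin -ff.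
have [cf _] := sf t0 bf.
have fE : (EFin \o (fine \o f)) = f by apply/funext => y /=; rewrite -ff.
rewrite fE in cf.
have Sf x : semigroup X t f x \is a fin_num.
  have nS := nonneg_borel_dsg X 0%R t nf.
  have := discounted_semigroupE X 0%R x (ltW t0) nf.
  rewrite mul0r oppr0 expR0 mul1e => ->.
  rewrite ge0_fin_numE ?nS.2//; apply: le_lt_trans (ltry C).
  by have := dsg_bound X 0%R t x nf fC; rewrite mul0r oppr0 expR0 mulr1.
rewrite (_ : (fun x => _) = (fun x => expR (- (a * t)) * fine (semigroup X t f x))%R).
  by move=> x; apply: cvgM; [exact: cvg_cst|exact: cf].
apply/funext => x; rewrite -(discounted_semigroupE X a x (ltW t0) nf).
by rewrite fineM.
Qed.

(** An excessive f is the supremum over t > 0 and k of the functions P_t (min(f, k)), which are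
    continuous by strong Feller. *)
Lemma seq_excessive_lsc a f : seq_excessive X a f -> lower_semicontinuous f.
Proof.
move=> ef x c cf; have [nf fle _] := ef.
have [t t0 ct] := seq_excessive_near ef cf.
pose fk k (y : E) : \bar R := mine (f y) k%:R%:E.
have nfk k : nonneg_borel (fk k).
  split; first by apply: measurable_mine => //; exact: nf.1.
  by move=> y; rewrite /fk le_min nf.2/= lee_fin.
have Pk : P a t (fk k) x @[k --> \oo] --> P a t f x.
  rewrite /dsg (_ : \int[discounted X a t x]_y f y = \int[discounted X a t x]_y limn (fk ^~ y)).
    apply: cvg_monotone_convergence => //.
    - by move=> n; exact: (nfk n).1.
    - by move=> n y _; exact: (nfk n).2.
    - move=> y _ n p np; rewrite /fk le_min ge_min lexx/= ge_min lee_fin ler_nat np.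
      by rewrite orbT.
  apply: eq_integral => y _; apply/esym/cvg_lim => //.
  have := nf.2 y; case fy : (f y) => [s| |//] s0.
    apply: cvg_near_cst; near=> n; rewrite /fk fy; apply/min_l.
    by rewrite lee_fin; near: n; exact: nbhs_infty_ger.
  rewrite (_ : fk ^~ y = fun n => n%:R%:E); first by apply/cvgeryP; exact: cvgr_idn.
  by apply/funext => n; rewrite /fk fy min_r// leey.
have [k ck] : exists k, c%:E < P a t (fk k) x.
  apply: contrapT => H; move: ct; apply/negP; rewrite -leNgt.
  rewrite -(cvg_lim _ Pk)//; apply: lime_le; first by apply/cvg_ex; eexists; exact: Pk.
  by apply: nearW => k; rewrite leNgt; apply/negP => ck; apply: H; exists k.
have fkC y : fk k y <= k%:R%:E by rewrite /fk ge_min lexx orbT.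
have Pfin y : P a t (fk k) y \is a fin_num.
  rewrite ge0_fin_numE; last exact: (nonneg_borel_dsg X a t (nfk k)).2.
  exact: le_lt_trans (dsg_bound X a t y (nfk k) fkC) (ltry _).
have cP : continuous (fun y => fine (P a t (fk k) y)).
  exact: dsg_continuous t0 (nfk k) fkC.
exists [set y | c < fine (P a t (fk k) y)]%R.
  apply: (cvgr_gt (fine (P a t (fk k) x))); first exact: cP.
  by rewrite -lte_fin fineK.
move=> y /=; rewrite -lte_fin fineK// => /lt_le_trans; apply.
apply: le_trans (fle t y (ltW t0)); apply: dsg_le => //.
by move=> z; rewrite /fk ge_min lexx.
Unshelve. all: by end_near. Qed.

End strong_feller_regularity.

(** * Symmetry of potentials and duality for the resolvent density *)

Section symmetric_resolvent.
Context {R : realType} (E : pmetricType R) (X : hunt_process E).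
Variable m : {sigma_finite_measure set (borel E) -> \bar R}.
Hypothesis symm : forall (t : R) (f g : E -> \bar R), (0 < t)%R ->
  nonneg_borel f -> nonneg_borel g ->
  \int[m]_x (f x * semigroup X t g x) = \int[m]_x (semigroup X t f x * g x).
Variable r : R -> E -> E -> \bar R.
Hypothesis rd : resolvent_density X m r.
Variable a : R.
Hypothesis a0 : (0 < a)%R.
Local Notation leb := (@lebesgue_measure R).
Local Notation P t f := (dsg X a t f).
Local Notation U f := (potential_op X a f).

Lemma dsg_sym t (f g : E -> \bar R) : (0 <= t)%R ->
  nonneg_borel f -> nonneg_borel g ->
  \int[m]_x (f x * P t g x) = \int[m]_x (P t f x * g x).
Proof.
move=> t0 nf ng; move: t0; rewrite le_eqVlt => /orP[/eqP <-|t0].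
  by apply: eq_integral => x _; rewrite !dsg_time0.
under eq_integral do rewrite -(discounted_semigroupE X a _ (ltW t0) ng) muleCA.
have nSg h : nonneg_borel h -> nonneg_borel (semigroup X t h).
  move=> nh; have [mh h0] := nonneg_borel_dsg X 0%R t nh.
  have E0 : semigroup X t h = dsg X 0%R t h.
    apply/funext => x; rewrite -(discounted_semigroupE X 0%R x (ltW t0) nh).
    by rewrite mul0r oppr0 expR0 mul1e.
  by rewrite E0.
rewrite ge0_integralZl//; last 2 first.
- by apply: emeasurable_funM; [exact: nf.1|exact: (nSg _ ng).1].
- by move=> x _; rewrite mule_ge0 ?nf.2// (nSg _ ng).2.
rewrite symm// -ge0_integralZl//; last 2 first.
- by apply: emeasurable_funM; [exact: (nSg _ nf).1|exact: ng.1].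
- by move=> x _; rewrite mule_ge0 ?ng.2// (nSg _ nf).2.
by apply: eq_integral => x _; rewrite muleA discounted_semigroupE// ltW.
Qed.

Lemma potential_op_sym (f g : E -> \bar R) :
  nonneg_borel f -> nonneg_borel g ->
  \int[m]_x (f x * U g x) = \int[m]_x (U f x * g x).
Proof.
move=> nf ng.
have mF (h k : E -> \bar R) : nonneg_borel h -> nonneg_borel k ->
    measurable_fun [set: R * borel E] (fun p : R * borel E => k p.2 * P p.1 h p.2).
  move=> nh nk; apply: emeasurable_funM; last exact: measurable_dsg2.
  exact: measurableT_comp nk.1 measurable_snd.
have F0 (h k : E -> \bar R) : nonneg_borel h -> nonneg_borel k ->
    forall p : R * borel E, 0 <= k p.2 * P p.1 h p.2.
  by move=> nh nk p; rewrite mule_ge0 ?nk.2//; exact: (nonneg_borel_dsg X a _ nh).2.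
have UE (h k : E -> \bar R) : nonneg_borel h -> nonneg_borel k ->
    \int[m]_x (k x * U h x) = \int[leb]_(s in `[0%R, +oo[) \int[m]_x (k x * P s h x).
  move=> nh nk.
  have H := @fubini_tonelli_domain R _ _ _ (borel E) leb `[0%R, +oo[%classic
    (measurable_itv _) _ (mF _ _ nh nk) (F0 _ _ nh nk) m.
  rewrite -[RHS]H; apply: eq_integral => x _ /=.
  rewrite -ge0_integralZl//.
  - by apply: measurable_funTS; exact: measurable_dsg_time.
  - by move=> s _; exact: (nonneg_borel_dsg X a _ nh).2.
  - exact: nk.2.
transitivity (\int[leb]_(s in `[0%R, +oo[) \int[m]_x (f x * P s g x)).
  exact: UE.
transitivity (\int[leb]_(s in `[0%R, +oo[) \int[m]_x (g x * P s f x)).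
  apply: eq_integral => s; rewrite inE/= in_itv/= andbT => s0.
  by rewrite (dsg_sym s0 nf ng); apply: eq_integral => x _; rewrite muleC.
by rewrite -(UE _ _ nf ng); apply: eq_integral => x _; rewrite muleC.
Qed.

Let density_facts := rd (ltW a0).

Lemma measurable_density :
  measurable_fun [set: borel E * borel E] (fun p : borel E * borel E => r a p.1 p.2).
Proof. by have [] := density_facts. Qed.

Lemma measurable_density_swap :
  measurable_fun [set: borel E * borel E] (fun p : borel E * borel E => r a p.2 p.1).
Proof.
have ms : measurable_fun setT (fun p : borel E * borel E => (p.2, p.1)).
  exact: measurable_fun_pair measurable_snd measurable_fst.
exact: measurableT_comp measurable_density ms.
Qed.

Lemma seq_excessive_densityl y : seq_excessive X a (fun x => r a x y).
Proof. by have [_ _ _ er] := density_facts; exact: excessive_seq_excessive. Qed.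

Lemma seq_excessive_densityr x : seq_excessive X a (r a x).
Proof. by have [_ _ er _] := density_facts; exact: excessive_seq_excessive. Qed.

Lemma density_ge0 x y : 0 <= r a x y.
Proof. by have [[_ +] _ _] := seq_excessive_densityr x; apply. Qed.

Lemma potential_op_density f x : nonneg_borel f ->
  U f x = \int[m]_y (r a x y * f y).
Proof.
by move=> nf; have [_ rE _ _] := density_facts; rewrite -resolvent_potential_op// rE.
Qed.

(* The two sides are a-excessive in y; testing them against the density r a z
   shows that they have the same a-potential, hence they agree everywhere. *)
Lemma dual_potential_op (g : E -> \bar R) (C : R) y : nonneg_borel g ->
  (forall x, g x <= C%:E) -> \int[m]_x (r a x y * g x) = U g y.
Proof.
move=> ng gC.
have gE x : g x = (fine (g x))%:E.
  by rewrite fineK// ge0_fin_numE ?ng.2// (le_lt_trans (gC x))// ltry.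
have mw : measurable_fun [set: borel E] (fun x : borel E => fine (g x)).
  by apply: measurableT_comp ng.1; exact: fine_measurable.
have w0 x : (0 <= fine (g x))%R by rewrite fine_ge0// ng.2.
pose f2 y := \int[m]_x (r a x y * g x).
have e1 : seq_excessive X a (U g).
  rewrite (_ : U g = fun y => \int[m]_x (r a y x * (fine (g x))%:E)).
    exact: (seq_excessive_integral m (rho := fun p => r a p.1 p.2)
      measurable_density seq_excessive_densityl mw w0).
  apply/funext => z; rewrite potential_op_density//.
  by apply: eq_integral => x _; rewrite -gE.
have e2 : seq_excessive X a f2.
  rewrite (_ : f2 = fun y => \int[m]_x (r a x y * (fine (g x))%:E)).
    exact: (seq_excessive_integral m (rho := fun p => r a p.2 p.1)
      measurable_density_swap seq_excessive_densityr mw w0).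
  by apply/funext => z; apply: eq_integral => x _; rewrite -gE.
have UU x : U f2 x = U (U g) x.
  have [n2 _ _] := e2; have [n1 _ _] := e1.
  have [nr _ _] := seq_excessive_densityr x.
  pose F (p : borel E * borel E) := r a x p.1 * (r a p.2 p.1 * g p.2).
  have mF : measurable_fun setT F.
    apply: emeasurable_funM; first exact: measurableT_comp nr.1 measurable_fst.
    apply: emeasurable_funM; first exact: measurable_density_swap.
    exact: measurableT_comp ng.1 measurable_snd.
  have F0 p : 0 <= F p by rewrite !mule_ge0 ?ng.2 ?density_ge0.
  transitivity (\int[m]_y \int[m]_z F (y, z)).
    rewrite potential_op_density//; apply: eq_integral => z _.
    rewrite /F/= ge0_integralZl//.
    - apply: emeasurable_funM ng.1.
      by have [[]] := seq_excessive_densityl z.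
    - by move=> t _; rewrite mule_ge0 ?ng.2 ?density_ge0.
    - exact: density_ge0.
  rewrite (@fubini_tonelli _ _ _ _ _ m m F mF F0).
  transitivity (\int[m]_z (g z * U (r a x) z)).
    apply: eq_integral => z _; rewrite potential_op_density// /F/=.
    rewrite -ge0_integralZl//.
    - by apply: eq_integral => t _; rewrite muleC [r a z t * _]muleC -muleA.
    - by apply: emeasurable_funM nr.1; have [[]] := seq_excessive_densityr z.
    - by move=> t _; rewrite mule_ge0 ?density_ge0.
    - exact: ng.2.
  rewrite potential_op_sym// [RHS]potential_op_density//.
  by apply: eq_integral => z _; rewrite muleC.
have Ufin x : U (U g) x < +oo.
  have [n1 _ _] := e1; apply: le_lt_trans (ltry (C / a / a)).
  by apply: potential_op_bound => // z; exact: potential_op_bound.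
apply/eqP; rewrite eq_le; apply/andP; split.
  exact: (seq_excessive_le (ltW a0) e2 e1 UU (Ufin y)).
apply: (seq_excessive_le (ltW a0) e1 e2 (fun x => esym (UU x))).
by rewrite UU; exact: Ufin.
Qed.

End symmetric_resolvent.

(** * Sigma-finiteness of the reference measure *)

Lemma countable_sequence (T : pointedType) (A : set T) : countable A ->
  exists e : nat -> T, A `<=` range e.
Proof.
move=> /countable_injP [f fA].
(* Indices not attained by [f] get the default [point], which also covers an empty [A]; only the
   inclusion matters. *)
pose e i := if pselect (exists2 x, A x & f x = i) is left H
  then sval (cid2 H) else point.
exists e => x Ax; exists (f x) => //; rewrite /e; case: pselect => [H|]; last first.
  by case; exists x.
by case: cid2 => y /= Ay fy; apply: fA; rewrite ?inE.
Qed.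

Lemma compact_increasing_cover (T : topologicalType) (K : set T)
    (V : nat -> set T) : compact K -> (forall n, open (V n)) ->
  (forall n p, (n <= p)%N -> V n `<=` V p) -> K `<=` \bigcup_n V n ->
  exists n, K `<=` V n.
Proof.
move=> /compact_near_coveringP cK oV VV KV.
have : \forall n \near \oo, K `<=` V n.
  apply: cK => x /KV [n _ Vx]; exists (V n, [set p | (n <= p)%N]) => /=.
    by split; [apply: open_nbhs_nbhs; split|exists n].
  by move=> [y p] /= [Vy np]; exact: VV np _ Vy.
by case=> n _ /(_ n (leqnn n)); exists n.
Qed.

Lemma sigma_finite_pairs d (T : measurableType d) (R : realType)
    (nu : {measure set T -> \bar R}) (G : nat -> nat -> set T) :
  (forall i n, measurable (G i n) /\ nu (G i n) < +oo) ->
  (forall x, exists i n, G i n x) -> sigma_finite setT nu.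
Proof.
move=> mG cG.
exists (fun k => if unpickle k is Some p then G p.1 p.2 else set0).
  apply/seteqP; split=> // x _; have [i [n Gx]] := cG x.
  by exists (pickle (i, n)) => //; rewrite pickleK.
move=> k; case: unpickle => [p|]; first exact: mG.
by rewrite measure0; split.
Qed.

Section locally_compact_separable.
Context {R : realType} (E : pmetricType R).
Variable m : {measure set (borel E) -> \bar R}.
Hypotheses (E_lcs : lcs_metric E) (m_radon : radon_full_support m).

(** The cover consists of interiors of balls of radius 1/(n+1) about a dense sequence, those of
    infinite measure being replaced by the empty set. Each point has a compact neighbourhood, of
    finite measure, and lies in such a ball inside it. *)
Lemma finite_measure_open_cover : exists O : nat -> set E,
  [/\ forall k, open (O k), forall k, m (O k) < +oo & \bigcup_k O k = setT].
Proof.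
have [E_lc [A /countable_sequence [e Ae] dA]] := E_lcs.
pose B i n : set E := (ball (e i) (n.+1%:R^-1))°.
pose C i n := if m (B i n) < +oo then B i n else set0.
have oC i n : open (C i n).
  by rewrite /C; case: ifP => _; [exact: open_interior|exact: open0].
have mC i n : m (C i n) < +oo.
  by rewrite /C; case: ifP => // _; rewrite measure0.
have cC x : exists i n, C i n x.
  have [K Kx [cK clK]] := E_lc x I.
  have mK : m K < +oo by apply: m_radon.1.
  have /nbhs_ballP[d /= d0 dK] : nbhs x K.
    have : \forall y \near x, setT y -> K y by exact: Kx.
    by apply: filterS => y /(_ I).
  (* The centre is taken within half a radius of [x]: the ball then contains a neighbourhood of [x]
     and stays inside [ball x d]. *)
  have [n nd] : exists n, (n.+1%:R^-1 < d / 2)%R.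
    have : \forall n \near \oo, (n.+1%:R^-1 < d / 2)%R.
      by apply: (cvgr_lt (0 : R)%R); [exact: cvg_invSn|rewrite divr_gt0].
    by case=> n _ /(_ n (leqnn n)); exists n.
  have n0 : (0 < n.+1%:R^-1 / 2 :> R)%R by rewrite divr_gt0 ?invr_gt0.
  have [y [yx Ay]] : (ball x (n.+1%:R^-1 / 2))° `&` A !=set0.
    apply: dA; last exact: open_interior.
    by exists x; exact: nbhsx_ballx.
  have [i _ iy] := Ae y Ay.
  have xy : ball x (n.+1%:R^-1 / 2) y by exact: interior_subset.
  have BK : B i n `<=` K.
    move=> z /interior_subset; rewrite iy => yz; apply: dK.
    apply: (@le_ball _ _ _ (n.+1%:R^-1 / 2 + n.+1%:R^-1)%R); last exact: ball_triangle xy yz.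
    by rewrite [leRHS]splitr; apply: lerD; rewrite ?(ltW nd)// ler_pM2r// ltW// (lt_le_trans nd)// ler_pdivrMr// ler_peMr ?ler1n// ltW.
  exists i, n; rewrite /C ifT.
    apply: filterS (nbhsx_ballx x _ n0) => z xz; rewrite iy.
    by rewrite [n.+1%:R^-1%R]splitr; apply: ball_triangle xz; exact: ball_sym.
  apply: le_lt_trans mK; apply: le_measure => //; rewrite inE.
    by apply: open_borel; exact: open_interior.
  by rewrite -[K]setCK; apply: measurableC; apply: open_borel; exact: closed_openC.
exists (fun k => if unpickle k is Some p then C p.1 p.2 else set0); split.
- by move=> k; case: unpickle => [p|]; [exact: oC|exact: open0].
- by move=> k; case: unpickle => [p|]; [exact: mC|rewrite measure0].
- apply/seteqP; split=> // x _; have [i [n Cx]] := cC x.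
  by exists (pickle (i, n)) => //; rewrite pickleK.
Qed.

Lemma radon_sigma_finite : sigma_finite setT m.
Proof.
have [V [oV mVo cV]] := finite_measure_open_cover.
exists V => // k; split; [by apply: open_borel; exact: oV|exact: mVo].
Qed.

Lemma compact_finite_measure_open (K : set E) : compact K ->
  exists G : set E, [/\ open G, m G < +oo & K `<=` G].
Proof.
have [V [oV mVo cV]] := finite_measure_open_cover.
pose W n : set E := \big[setU/set0]_(i < n) V i.
have oW n : open (W n).
  by apply: (big_ind open) => [|A B|i _]; [exact: open0|exact: openU|exact: oV].
have mW n : m (W n) < +oo.
  rewrite /W; suff [] : measurable (\big[setU/set0]_(i < n) V i : set (borel E)) /\
    m (\big[setU/set0]_(i < n) V i) < +oo by [].
  elim/big_ind : _ => [|A B [mA Afin] [mB Bfin]|i _].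
  - by rewrite measure0.
  - split; first exact: measurableU.
    by apply: le_lt_trans (measureU2 m mA mB) _; exact: lte_add_pinfty.
  - by split; [apply: open_borel; exact: oV|exact: mVo].
move=> cK; have [| |n KW] := compact_increasing_cover cK oW.
- by move=> n p np; exact: subset_bigsetU.
- move=> x _; have : (\bigcup_k V k) x by rewrite cV.
  by case=> k _ Vx; exists k.+1 => //; rewrite /W big_ord_recr; right.
by exists (W n); split.
Qed.

End locally_compact_separable.

(** * Sigma-finiteness of a measure with bounded potential *)

Section potential_sigma_finite.
Context {R : realType} (E : pmetricType R) (X : hunt_process E).
Variable m : {sigma_finite_measure set (borel E) -> \bar R}.
Hypothesis sf : strong_feller X.
Hypothesis symm : forall (t : R) (f g : E -> \bar R), (0 < t)%R ->
  nonneg_borel f -> nonneg_borel g ->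
  \int[m]_x (f x * semigroup X t g x) = \int[m]_x (semigroup X t f x * g x).
Variable r : R -> E -> E -> \bar R.
Hypothesis rd : resolvent_density X m r.
Variable a : R.
Hypothesis a0 : (0 < a)%R.

Lemma potential_op_cst1_gt0 y : 0 < potential_op X a (cst 1) y.
Proof.
have n1 : nonneg_borel (cst 1 : E -> \bar R).
  by split=> [|x]; [exact: measurable_cst|exact: lee01].
have l1 : lower_semicontinuous (cst 1 : E -> \bar R).
  by move=> x c c1; exists setT => //; exact: filterT.
(* The constant 1/2 stands for any number strictly between 0 and 1. *)
have [|n _ /(_ n (leqnn n)) /=] := @occupation_lsc_near R E X a (cst 1) y 2^-1 n1 l1.
  by rewrite lte_fin invf_lt1// ltr1n.
rewrite -lee_pdivrMl// => H; apply: (@lt_le_trans _ _ (occupation X a n.+1%:R^-1 (cst 1) y)).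
  by apply: lt_le_trans H; rewrite mule_gt0// lte_fin invr_gt0.
have n0 : (0 <= n.+1%:R^-1 :> R)%R by rewrite invr_ge0.
rewrite (potential_op_decomp X a y n0 n1) leeDl//.
have nU : nonneg_borel (potential_op X a (cst 1)).
  exact: nonneg_borel_time_integral.
exact: (nonneg_borel_dsg X a _ nU).2.
Qed.

(** Were r(., y) identically 0, [dual_potential_op] would give U 1(y) = 0. That identity holds at
    every y, so no null set of y is lost. *)
Lemma density_positive y : exists x, 0 < r a x y.
Proof.
apply: contrapT => /forallNP H; have := potential_op_cst1_gt0 y.
have n1 : nonneg_borel (cst 1 : E -> \bar R).
  by split=> [|x]; [exact: measurable_cst|exact: lee01].
rewrite -(dual_potential_op symm rd a0 y n1 (fun=> lexx _)).
rewrite integral0_eq ?ltxx// => x _; rewrite mule1; apply/eqP.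
rewrite eq_le (density_ge0 rd a0) andbT leNgt; apply/negP; exact: H.
Qed.

(** Chebyshev's inequality bounds by (n+1) M the mass of the set of y with r(e_i, y) > 1/(n+1).
    These sets cover: r(., y) is lower semicontinuous and positive somewhere, hence positive at some
    point e_i of a dense sequence. *)
Lemma potential_sigma_finite (nu : {measure set (borel E) -> \bar R}) (M : R) :
  lcs_metric E -> (forall x, potential r nu a setT x <= M%:E) ->
  sigma_finite setT nu.
Proof.
move=> [_ [A /countable_sequence [e Ae] dA]] rM.
have mr x : measurable_fun [set: borel E] (r a x : borel E -> \bar R).
  by have [[]] := seq_excessive_densityr rd a0 x.
pose G i n : set (borel E) := [set y | (n.+1%:R^-1)%:E < r a (e i) y].
have mG i n : measurable (G i n).
  rewrite -[X in measurable X]setTI; exact: emeasurable_fun_o_infty.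
apply: (@sigma_finite_pairs _ _ _ _ G) => [i n|y].
  split=> //; have := rM (e i); rewrite /potential => rMi.
  have : (n.+1%:R^-1)%:E * nu (G i n) <= M%:E.
    apply: le_trans rMi; rewrite -integral_cst//.
    apply: (@le_trans _ _ (\int[nu]_(y in G i n) r a (e i) y)).
      apply: ge0_le_integral => //.
      - by move=> z _; rewrite lee_fin invr_ge0.
      - by apply: measurable_funTS; exact: mr.
      - by move=> z /ltW.
    apply: ge0_subset_integral => //.
    by move=> z _; exact: (density_ge0 rd a0).
  by rewrite lee_pdivrMl// => /le_lt_trans; apply; rewrite -EFinM ltry.
have [x xy] := density_positive y.
have /lower_semicontinuousP/(_ 0%R) oU := seq_excessive_lsc sf (seq_excessive_densityl rd a0 y).
have [z [/= zy /Ae [i _ iz]]] := dA _ (ex_intro _ x xy) oU.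
have [q zq qy] := lte_real_between zy.
have [n nq] : exists n, (n.+1%:R^-1 < q)%R.
  have : \forall n \near \oo, (n.+1%:R^-1 < q)%R.
    by apply: (cvgr_lt (0 : R)%R); [exact: cvg_invSn|].
  by case=> n _ /(_ n (leqnn n)); exists n.
by exists i, n; rewrite /G/= iz; apply: lt_trans qy; rewrite lte_fin.
Qed.

End potential_sigma_finite.

(** The difference of the two sides is (|p| t - |q| s)^2 / (2 s t). In the Hardy argument p, q are
    values of [u] at two points and s, t the values of the supermedian function there. *)
Lemma weighted_amgm (R : realFieldType) (p q s t : R) : (0 < s)%R -> (0 < t)%R ->
  (`|p| * `|q| <= 2^-1 * (p ^+ 2 / s * t) + 2^-1 * (s * (q ^+ 2 / t)))%R.
Proof.
move=> s0 t0; rewrite -subr_ge0 -(real_normK (num_real p)) -(real_normK (num_real q)).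
set x := `|p|%R; set y := `|q|%R.
have -> : (2^-1 * (x ^+ 2 / s * t) + 2^-1 * (s * (y ^+ 2 / t)) - x * y =
  (x * t - y * s) ^+ 2 / (2 * s * t))%R.
  by field; rewrite !gt_eqF.
by rewrite divr_ge0 ?sqr_ge0// !mulr_ge0// ltW.
Qed.

Lemma nonneg_borel_cst (R : realType) (E : pmetricType R) (c : R) : (0 <= c)%R ->
  nonneg_borel (cst c%:E : E -> \bar R).
Proof. by split=> [|x]; [exact: measurable_cst|rewrite lee_fin]. Qed.

(** * The Hardy inequality: pointwise estimate and symmetrisation *)

Section hardy.
Context {R : realType} (E : pmetricType R) (X : hunt_process E).
Variable m : {sigma_finite_measure set (borel E) -> \bar R}.
Hypothesis symm : forall (t : R) (f g : E -> \bar R), (0 < t)%R ->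
  nonneg_borel f -> nonneg_borel g ->
  \int[m]_x (f x * semigroup X t g x) = \int[m]_x (semigroup X t f x * g x).
Local Notation P a t f := (dsg X a t f).

Lemma semigroup_dsg0 t f x : (0 <= t)%R -> nonneg_borel f ->
  semigroup X t f x = P 0%R t f x.
Proof.
by move=> t0 nf; rewrite -discounted_semigroupE// mul0r oppr0 expR0 mul1e.
Qed.

Lemma dsg_discount a t f x : nonneg_borel f ->
  P a t f x = (expR (- (a * t)))%:E * P 0%R t f x.
Proof.
by move=> nf; rewrite /dsg !integral_discounted// mul0r oppr0 expR0 mul1e.
Qed.

Lemma nonneg_borelZ (k : \bar R) (g : E -> \bar R) : 0 <= k -> nonneg_borel g ->
  nonneg_borel (fun x => k * g x).
Proof.
by move=> k0 [mg g0]; split=> [|x]; [exact: measurable_funeM|rewrite mule_ge0].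
Qed.

Lemma nonneg_borelD (g h : E -> \bar R) : nonneg_borel g -> nonneg_borel h ->
  nonneg_borel (fun x => g x + h x).
Proof.
by move=> [mg g0] [mh h0]; split=> [|x]; [exact: emeasurable_funD|rewrite adde_ge0].
Qed.

Lemma nonneg_borelM (g h : E -> \bar R) : nonneg_borel g -> nonneg_borel h ->
  nonneg_borel (fun x => g x * h x).
Proof.
by move=> [mg g0] [mh h0]; split=> [|x]; [exact: emeasurable_funM|rewrite mule_ge0].
Qed.

Lemma dsgZ a t x (k : \bar R) (g : E -> \bar R) : 0 <= k -> nonneg_borel g ->
  P a t (fun y => k * g y) x = k * P a t g x.
Proof. by move=> k0 [mg g0]; rewrite /dsg ge0_integralZl. Qed.

Lemma dsgD a t x (g h : E -> \bar R) : nonneg_borel g -> nonneg_borel h ->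
  P a t (fun y => g y + h y) x = P a t g x + P a t h x.
Proof. by move=> [mg g0] [mh h0]; rewrite /dsg ge0_integralD. Qed.

Variable u : E -> R.
Hypothesis mu : measurable_fun [set: borel E] (u : borel E -> R).

Let f := EFin \o u.

Let nfp : nonneg_borel f^\+.
Proof. by split=> [|x]; [apply: measurable_funepos; exact/measurable_EFinP|]. Qed.

Let nfn : nonneg_borel f^\-.
Proof. by split=> [|x]; [apply: measurable_funeneg; exact/measurable_EFinP|]. Qed.

Let nabs : nonneg_borel (fun x => `|u x|%:E).
Proof.
split=> [|x]; last by rewrite lee_fin.
by apply/measurable_EFinP; exact: measurableT_comp.
Qed.

Lemma semigroup_sub t x : (0 <= t)%R ->
  semigroup X t f x = P 0%R t f^\+ x - P 0%R t f^\- x.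
Proof.
move=> t0; rewrite -!semigroup_dsg0// /semigroup integralE; congr (_ - _).
  apply: eq_integral => w _; rewrite funeposE.
  by case: (Defs.path t w) => [y|] /=; rewrite ?funeposE ?maxxx.
apply: eq_integral => w _; rewrite funenegE.
case: (Defs.path t w) => [y|] /=; first by rewrite funenegE.
by rewrite oppr0 maxxx.
Qed.

Lemma measurable_semigroup t : (0 <= t)%R ->
  measurable_fun [set: borel E] (semigroup X t f : borel E -> \bar R).
Proof.
move=> t0; rewrite (_ : semigroup X t f = P 0%R t f^\+ \- P 0%R t f^\-).
  by apply: emeasurable_funB; [exact: (nonneg_borel_dsg X 0%R t nfp).1|
    exact: (nonneg_borel_dsg X 0%R t nfn).1].
by apply/funext => x; rewrite semigroup_sub.
Qed.

Lemma semigroup_le_abs t x : (0 <= t)%R ->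
  `|fine (semigroup X t f x)|%:E <= P 0%R t (fun x => `|u x|%:E) x.
Proof.
move=> t0; apply: (@le_trans _ _ `|semigroup X t f x|).
  (* [fine] turns an infinite value into 0, for which the bound is trivial. *)
  by case: (semigroup X t f x) => [s| |]; rewrite /= ?normr0 ?lee_fin// leey.
rewrite semigroup_sub//; apply: le_trans (lee_abs_sub _ _) _.
rewrite !gee0_abs; [|exact: (nonneg_borel_dsg X 0%R t nfn).2|
  exact: (nonneg_borel_dsg X 0%R t nfp).2].
rewrite -dsgD//; apply: dsg_le => //; first exact: nonneg_borelD.
by move=> y; have /(congr1 (fun g => g y)) /= <- := fune_abse f.
Qed.

Variables (H : E -> R) (c C : R).
Hypothesis (c0 : (0 < c)%R) (mH : measurable_fun [set: borel E] (H : borel E -> R)).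
Hypothesis (Hc : forall x, (c <= H x)%R) (HC : forall x, (H x <= C)%R).

Let H0 x : (0 < H x)%R. Proof. exact: lt_le_trans c0 (Hc x). Qed.

Let nH : nonneg_borel (EFin \o H).
Proof. by split=> [|x]; [exact/measurable_EFinP|rewrite lee_fin ltW]. Qed.

Let uH x : \bar R := (u x ^+ 2 / H x)%:E.

Lemma measurable_weight :
  measurable_fun [set: borel E] (fun x : borel E => (u x ^+ 2 / H x)%:E).
Proof.
apply/measurable_EFinP; apply: measurable_funM; first exact: measurable_funX.
(* Since [H] is positive, 1/H is exp(-ln H), a composition of measurable maps. *)
rewrite (_ : (fun x => _) = (fun x => expR (- ln (H x)))%R).
  apply: measurableT_comp => //; apply: measurableT_comp => //.
  exact: measurableT_comp mH.
by apply/funext => y; rewrite expRN lnK// posrE.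
Qed.

Let nuH : nonneg_borel uH.
Proof.
split=> [|x]; last by rewrite lee_fin divr_ge0 ?sqr_ge0// ltW.
exact: measurable_weight.
Qed.

(** Freeze [x] and apply [weighted_amgm] to [u x] and [u y] with weights [H x] and [H y]; P_t then
    integrates in y. *)
Lemma hardy_pointwise a t x :
  `|u x|%:E * P a t (fun x => `|u x|%:E) x <=
  (2^-1)%:E * (uH x * P a t (EFin \o H) x) +
  (2^-1)%:E * ((H x)%:E * P a t uH x).
Proof.
have uHx : 0 <= uH x := nuH.2 x.
have Hx : 0 <= (H x)%:E by rewrite lee_fin ltW.
have n1 := nonneg_borelZ uHx nH; have n2 := nonneg_borelZ Hx nuH.
have h0 : 0 <= (2^-1)%:E :> \bar R by rewrite lee_fin.
have n3 := nonneg_borelZ h0 n1; have n4 := nonneg_borelZ h0 n2.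
rewrite -(dsgZ a t x uHx nH) -(dsgZ a t x Hx nuH) -(dsgZ a t x h0 n1).
rewrite -(dsgZ a t x h0 n2) -(dsgD a t x n3 n4) -dsgZ//; apply: dsg_le.
- exact: nonneg_borelZ.
- exact: nonneg_borelD.
- by move=> y; rewrite /= /uH -!EFinM -EFinD lee_fin; exact: weighted_amgm.
Qed.

Local Notation B a t := (\int[m]_x (uH x * P a t (EFin \o H) x)).

(** Symmetry makes the two halves of [hardy_pointwise] equal after integration: \int H P_t(u^2/H) dm
    = \int (u^2/H) P_t H dm. *)
Lemma hardy_abs a t : (0 <= t)%R ->
  \int[m]_x (`|u x|%:E * P a t (fun x => `|u x|%:E) x) <= B a t.
Proof.
move=> t0.
have h0 : 0 <= (2^-1)%:E :> \bar R by rewrite lee_fin.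
have nP g : nonneg_borel g -> nonneg_borel (P a t g) by exact: nonneg_borel_dsg.
have n1 := nonneg_borelM nuH (nP _ nH); have n2 := nonneg_borelM nH (nP _ nuH).
apply: (@le_trans _ _ (\int[m]_x ((2^-1)%:E * (uH x * P a t (EFin \o H) x) +
    (2^-1)%:E * ((H x)%:E * P a t uH x)))).
  apply: ge0_le_integral => //.
  - by move=> x _; exact: (nonneg_borelM nabs (nP _ nabs)).2.
  - exact: (nonneg_borelM nabs (nP _ nabs)).1.
  - exact: (nonneg_borelD (nonneg_borelZ h0 n1) (nonneg_borelZ h0 n2)).1.
  - by move=> x _; exact: hardy_pointwise.
rewrite ge0_integralD//; [|by move=> x _; exact: (nonneg_borelZ h0 n1).2
  |exact: (nonneg_borelZ h0 n1).1|by move=> x _; exact: (nonneg_borelZ h0 n2).2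
  |exact: (nonneg_borelZ h0 n2).1].
rewrite !ge0_integralZl//; [|exact: n2.1|by move=> x _; exact: n2.2
  |exact: n1.1|by move=> x _; exact: n1.2].
have -> : \int[m]_x ((H x)%:E * P a t uH x) = B a t.
  rewrite (dsg_sym symm a t0 nH nuH).
  by apply: eq_integral => x _; rewrite muleC.
rewrite -ge0_muleDl// -EFinD (_ : (2^-1 + 2^-1)%R = 1%R) ?mul1e//.
by field.
Qed.

End hardy.

(** * The Hardy inequality in terms of the approximating forms *)

Section hardy_inequality.
Context {R : realType} (E : pmetricType R) (X : hunt_process E).
Variable m : {sigma_finite_measure set (borel E) -> \bar R}.
Hypothesis symm : forall (t : R) (f g : E -> \bar R), (0 < t)%R ->
  nonneg_borel f -> nonneg_borel g ->
  \int[m]_x (f x * semigroup X t g x) = \int[m]_x (semigroup X t f x * g x).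
Local Notation P a t f := (dsg X a t f).
Variable u : E -> R.
Hypothesis mu : measurable_fun [set: borel E] (u : borel E -> R).
Hypothesis u2 : \int[m]_x (u x ^+ 2)%:E < +oo.

Let f := EFin \o u.
Let q t x := (u x * fine (semigroup X t f x))%R.
Let A := fine (\int[m]_x (u x ^+ 2)%:E).

Let AE : \int[m]_x (u x ^+ 2)%:E = A%:E.
Proof.
by rewrite fineK// ge0_fin_numE// integral_ge0// => x _; rewrite lee_fin sqr_ge0.
Qed.

Let nabs : nonneg_borel (fun x => `|u x|%:E).
Proof.
split=> [|x]; last by rewrite lee_fin.
by apply/measurable_EFinP; exact: measurableT_comp.
Qed.

Let n2 : nonneg_borel (fun x => (u x ^+ 2)%:E).
Proof.
split=> [|x]; last by rewrite lee_fin sqr_ge0.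
by apply/measurable_EFinP; exact: measurable_funX.
Qed.

Let mq t : (0 <= t)%R -> measurable_fun [set: borel E] (q t : borel E -> R).
Proof.
move=> t0; apply: measurable_funM => //.
by apply: measurableT_comp (measurable_semigroup X mu t0); exact: fine_measurable.
Qed.

Let q_le a t x : (0 <= t)%R ->
  (expR (- (a * t)))%:E * `|q t x|%:E <= `|u x|%:E * P a t (fun x => `|u x|%:E) x.
Proof.
move=> t0; rewrite (dsg_discount X a t x nabs) muleCA.
apply: lee_wpmul2l; first by rewrite lee_fin expR_ge0.
rewrite /q normrM EFinM; apply: lee_wpmul2l => //.
exact: semigroup_le_abs.
Qed.

Let q_int_le (H : E -> R) (c : R) a t : (0 <= t)%R -> (0 < c)%R ->
  measurable_fun [set: borel E] (H : borel E -> R) -> (forall x, c <= H x)%R ->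
  (expR (- (a * t)))%:E * \int[m]_x `|q t x|%:E <=
  \int[m]_x ((u x ^+ 2 / H x)%:E * P a t (EFin \o H) x).
Proof.
move=> t0 c0 mH Hc.
apply: le_trans (hardy_abs symm mu c0 mH Hc a t0).
have mnq : measurable_fun [set: borel E] (fun x : borel E => `|q t x|%:E).
  by apply/measurable_EFinP; apply: measurableT_comp => //; exact: mq.
rewrite -ge0_integralZl//; apply: ge0_le_integral => //.
- exact: measurable_funeM.
- exact: (nonneg_borelM nabs (nonneg_borel_dsg X a t nabs)).1.
- by move=> x _; exact: q_le.
Qed.

(** The case H = 1, a = 0 of [q_int_le], in the spirit of the L^2 contraction property; it makes
    [q t] integrable. *)
Let q_int_leA t : (0 <= t)%R -> \int[m]_x `|q t x|%:E <= A%:E.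
Proof.
move=> t0.
have := @q_int_le (cst 1%R) 1%R 0%R t t0 ltr01 (measurable_cst _) (fun=> lexx _).
rewrite mul0r oppr0 expR0 mul1e => /le_trans; apply.
rewrite -AE; apply: ge0_le_integral => //.
- move=> x _; apply: mule_ge0; first by rewrite lee_fin divr1 sqr_ge0.
  by apply: integral_ge0 => y _; rewrite lee_fin.
- rewrite /cst/=; under eq_fun do rewrite divr1.
  exact: (nonneg_borelM n2 (nonneg_borel_dsg X 0%R t (nonneg_borel_cst E ler01))).1.
- exact: n2.1.
- move=> x _; rewrite /cst/= divr1 -[leRHS]mule1; apply: lee_wpmul2l.
    by rewrite lee_fin sqr_ge0.
  have := @dsg_bound R E X 0%R t (cst 1%:E) 1%R x.
  by rewrite mul0r oppr0 expR0 mulr1; apply=> //; exact: nonneg_borel_cst ler01.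
Qed.

Let integrable_q t : (0 <= t)%R -> m.-integrable setT (EFin \o q t).
Proof.
move=> t0; apply/integrableP; split; first by apply/measurable_EFinP; exact: mq.
exact: le_lt_trans (q_int_leA t0) (ltry _).
Qed.

Let integrable_u2 : m.-integrable setT (EFin \o (fun x => u x ^+ 2)%R).
Proof.
apply/integrableP; split; first exact: n2.1.
by under eq_integral do rewrite gee0_abs ?lee_fin ?sqr_ge0//.
Qed.

Lemma approximating_formE t : (0 < t)%R ->
  (t * approximating_form X m t u u = A - \int[m]_x q t x)%R.
Proof.
move=> t0; rewrite /approximating_form mulrA divff ?gt_eqF// mul1r.
under eq_Rintegral => x _ do rewrite mulrBl -expr2 mulrC.
by rewrite RintegralB//; exact: integrable_q (ltW t0).
Qed.

Lemma hardy_inequality (H : E -> R) (c : R) a t : (0 <= a)%R -> (0 < t)%R ->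
  (0 < c)%R -> measurable_fun [set: borel E] (H : borel E -> R) ->
  (forall x, c <= H x)%R -> (forall x, P a t (EFin \o H) x <= (H x)%:E) ->
  \int[m]_x (u x ^+ 2 * ((H x - fine (P a t (EFin \o H) x)) / H x))%:E <=
  (t * (approximating_form X m t u u + a * A))%:E.
Proof.
move=> a0 t0 c0 mH Hc PH.
have H0 x : (0 < H x)%R by exact: lt_le_trans c0 (Hc x).
have nH : nonneg_borel (EFin \o H).
  by split=> [|x]; [exact/measurable_EFinP|rewrite lee_fin ltW].
have nPH := nonneg_borel_dsg X a t nH.
have PHE x : P a t (EFin \o H) x = (fine (P a t (EFin \o H) x))%:E.
  by rewrite fineK// ge0_fin_numE ?nPH.2// (le_lt_trans (PH x)) ?ltry.
have PHH x : (fine (P a t (EFin \o H) x) <= H x)%R by rewrite -lee_fin -PHE.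
set b := \int[m]_x `|q t x|%:E.
have b0 : 0 <= b by apply: integral_ge0 => x _; rewrite lee_fin.
set B := \int[m]_x ((u x ^+ 2 / H x)%:E * P a t (EFin \o H) x).
set L := \int[m]_x _.
have nu2H : nonneg_borel (fun x => (u x ^+ 2 / H x)%:E).
  split=> [|x]; last by rewrite lee_fin divr_ge0 ?sqr_ge0// ltW.
  exact: (measurable_weight mu c0 mH Hc).
have nL : nonneg_borel (fun x => (u x ^+ 2 * ((H x - fine (P a t (EFin \o H) x)) / H x))%:E).
  split=> [|x]; last by rewrite lee_fin mulr_ge0 ?sqr_ge0// divr_ge0 ?subr_ge0// ltW.
  under eq_fun do rewrite mulrCA mulrC.
  apply/measurable_EFinP; apply: measurable_funM.
    by apply/measurable_EFinP; exact: nu2H.1.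
  apply: measurable_funB => //.
  by apply: measurableT_comp nPH.1; exact: fine_measurable.
(* The weights (H - P_t H)/H and P_t H/H add up to 1. *)
have LB : L + B = A%:E.
  rewrite -AE /L /B -ge0_integralD//; last 4 first.
  - by move=> x _; exact: nL.2.
  - exact: nL.1.
  - by move=> x _; exact: (nonneg_borelM nu2H nPH).2.
  - exact: (nonneg_borelM nu2H nPH).1.
  apply: eq_integral => x _; rewrite [P _ _ _ _]PHE -EFinM -EFinD; congr EFin.
  by field; rewrite gt_eqF.
have Bb : (expR (- (a * t)))%:E * b <= B by exact: q_int_le (ltW t0) c0 mH Hc.
have bA : b <= A%:E by exact: q_int_leA (ltW t0).
have L0 : 0 <= L by apply: integral_ge0 => x _; exact: nL.2.
have B0 : 0 <= B by apply: integral_ge0 => x _; exact: (nonneg_borelM nu2H nPH).2.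
have bfin : b \is a fin_num.
  by rewrite ge0_fin_numE//; exact: le_lt_trans bA (ltry _).
have bR : (\int[m]_x q t x <= fine b)%R.
  rewrite -lee_fin (fineK bfin).
  apply: (@le_trans _ _ `|\int[m]_x q t x|%R%:E); first by rewrite lee_fin ler_norm.
  rewrite EFin_normr_Rintegral//; last exact: integrable_q (ltW t0).
  by apply: le_abse_integral => //; apply/measurable_EFinP; exact: mq (ltW t0).
rewrite mulrDr approximating_formE//.
(* What remains is L = A - B <= (A - b) + (1 - e^(-at)) b <= (A - \int q dm) + a t A, from 1 -
   e^(-at) <= a t and b <= A. *)
clear bfin; clearbody L B b; move: LB Bb bA bR b0 L0 B0.
case: L => [L| |]; case: B => [B| |]; case: b => [b'| |] //=.
rewrite -EFinD -EFinM !lee_fin => -[LB] Bb bA bR b0 L0 B0.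
have ex : (1 - expR (- (a * t)) <= a * t)%R.
  have := expR_ge1Dx (- (a * t))%R; lra.
have ex0 : (0 <= 1 - expR (- (a * t)))%R.
  by rewrite subr_ge0 -expR0 ler_expR oppr_le0 mulr_ge0// ltW.
have : ((1 - expR (- (a * t))) * b' <= a * t * A)%R by apply: ler_pM.
lra.
Qed.

End hardy_inequality.

(** The bundled measure equals [nu], so facts about [nu] can be transported along the equality to
    where Tonelli is available. *)
Lemma sigma_finite_pack d (T : measurableType d) (R : realType)
    (nu : {measure set T -> \bar R}) : sigma_finite setT nu ->
  exists nu' : {sigma_finite_measure set T -> \bar R},
    (nu' : {measure set T -> \bar R}) = nu.
Proof.
case: nu => f [c1 c2] sf.
pose S1 := @isSFinite.Build d T R f (sfinite_measure_sigma_finite sf).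
pose S2 := @isSigmaFinite.Build d T R f sf.
pose nu' : {sigma_finite_measure set T -> \bar R} := HB.pack f c1 c2 S1 S2.
by exists nu'.
Qed.

Lemma ae_imply d (T : measurableType d) (R : realType)
    (nu : {measure set T -> \bar R}) (P Q : T -> Prop) :
  (forall x, P x -> Q x) -> {ae nu, forall x, P x} -> {ae nu, forall x, Q x}.
Proof. by move=> PQ; apply: filterS. Qed.

(** * Energy bounds from potentials of functions and of measures *)

Section form_bounds.
Context {R : realType} (E : pmetricType R) (X : hunt_process E).
Variable m : {sigma_finite_measure set (borel E) -> \bar R}.
Variable D : dirichlet_form m.
Hypothesis assoc : associated X D.
Local Notation P a t f := (dsg X a t f).

Let symm : forall (t : R) (f g : E -> \bar R), (0 < t)%R ->
  nonneg_borel f -> nonneg_borel g ->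
  \int[m]_x (f x * semigroup X t g x) = \int[m]_x (semigroup X t f x * g x).
Proof. by case: assoc. Qed.

Definition energy_alpha (a : R) (u : E -> R) : R :=
  (energy D u u + a * \int[m]_x (u x ^+ 2))%R.

Lemma dom_measurable u : dom D u -> measurable_fun [set: borel E] (u : borel E -> R).
Proof.
by move=> /dom_L2 /andP[]; rewrite inE.
Qed.

Lemma dom_square u : dom D u -> \int[m]_x (u x ^+ 2)%:E < +oo.
Proof.
move=> /dom_L2 /Lfun2_integrable_sqr /integrableP[_].
by under eq_integral do rewrite gee0_abs ?lee_fin ?sqr_ge0//.
Qed.

(* h is truncated at N and shifted by N, so that it stays excessive, bounded
   and bounded away from 0. *)
Lemma hardy_supermedian (h : E -> \bar R) a t N : (0 <= a)%R -> (0 < t)%R ->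
  (0 < N)%R -> nonneg_borel h -> (forall x, P a t h x <= h x) ->
  exists phi : E -> R,
  [/\ measurable_fun [set: borel E] (phi : borel E -> R),
      forall x, (0 <= phi x)%R,
      forall x, h x <= N%:E -> h x <= P a t h x + (2 * N * phi x)%:E &
      forall u, dom D u -> \int[m]_x (u x ^+ 2 * phi x)%:E <=
        (t * (approximating_form X m t u u + a * \int[m]_x (u x ^+ 2)))%:E].
Proof.
move=> a0 t0 N0 nh hle.
pose k x : \bar R := mine (h x) N%:E.
have nN : nonneg_borel (cst N%:E : E -> \bar R) := nonneg_borel_cst E (ltW N0).
have nk : nonneg_borel k.
  split=> [|x]; last by rewrite /k le_min nh.2/= lee_fin ltW.
  by apply: measurable_mine => //; exact: nh.1.
have kN x : k x <= N%:E by rewrite /k ge_min lexx orbT.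
have kfin x : k x \is a fin_num.
  by rewrite ge0_fin_numE ?nk.2// (le_lt_trans (kN x))// ltry.
pose H x : R := (fine (k x) + N)%R.
have HE x : (H x)%:E = k x + N%:E by rewrite /H EFinD fineK.
have HN x : (N <= H x)%R by rewrite /H lerDr fine_ge0// nk.2.
have H2N x : (H x <= 2 * N)%R by rewrite -lee_fin HE mulrDl mul1r EFinD leeD2r.
have mH : measurable_fun [set: borel E] (H : borel E -> R).
  apply: measurable_funD => //; apply: measurableT_comp nk.1; exact: fine_measurable.
have HkN : EFin \o H = fun x => k x + cst N%:E x by apply/funext => x; exact: HE.
have PN x : P a t (cst N%:E) x <= N%:E.
  apply: le_trans (dsg_bound X a t x nN (fun=> lexx _)) _.
  rewrite lee_fin -[leRHS]mulr1 ler_pM2l// -expR0 ler_expR oppr_le0.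
  by rewrite mulr_ge0// ltW.
have Pk x : P a t k x <= k x.
  rewrite {2}/k le_min; apply/andP; split.
    by apply: le_trans (hle x); apply: dsg_le => // y; rewrite /k ge_min lexx.
  by apply: le_trans (PN x); exact: dsg_le.
have PH x : P a t (EFin \o H) x <= (H x)%:E.
  by rewrite HkN dsgD// HE leeD.
have nH : nonneg_borel (EFin \o H) by rewrite HkN; exact: nonneg_borelD.
have nPH := nonneg_borel_dsg X a t nH.
have PHfin x : P a t (EFin \o H) x \is a fin_num.
  by rewrite ge0_fin_numE ?nPH.2// (le_lt_trans (PH x))// ltry.
have H0 x : (0 < H x)%R by exact: lt_le_trans N0 (HN x).
have PHH x : (fine (P a t (EFin \o H) x) <= H x)%R by rewrite -lee_fin fineK.
exists (fun x => (H x - fine (P a t (EFin \o H) x)) / H x)%R; split.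
- apply: measurable_funM.
    apply: measurable_funB => //.
    by apply: measurableT_comp nPH.1; exact: fine_measurable.
  rewrite (_ : (fun x => _) = (fun x => expR (- ln (H x)))%R).
    apply: measurableT_comp => //; apply: measurableT_comp => //.
    exact: measurableT_comp mH.
  by apply/funext => y; rewrite expRN lnK// posrE.
- by move=> x; rewrite divr_ge0 ?subr_ge0// ltW.
- move=> x hN; have kh : k x = h x by rewrite /k min_l.
  have Pkh : P a t k x <= P a t h x.
    by apply: dsg_le => // y; rewrite /k ge_min lexx.
  have : (H x)%:E <= P a t h x + N%:E + (2 * N * ((H x - fine (P a t (EFin \o H) x)) / H x))%:E.
    apply: (@le_trans _ _ (P a t (EFin \o H) x + (2 * N * ((H x - fine (P a t (EFin \o H) x)) / H x))%:E)).
      rewrite -[X in X + _]fineK// -EFinD lee_fin.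
      rewrite -lerBlDl mulrA ler_pdivlMr// mulrC.
      by apply: ler_wpM2r => //; rewrite subr_ge0.
    rewrite leeD2r// HkN dsgD//; exact: leeD.
  rewrite HE kh addeAC leeD2rE//.
- move=> u du.
  rewrite (_ : \int[m]_x (u x ^+ 2) = fine (\int[m]_x (u x ^+ 2)%:E))%R//.
  exact: (hardy_inequality symm (dom_measurable du) (dom_square du) a0 t0 N0 mH HN PH).
Qed.

Lemma approximating_form_cvg u : dom D u ->
  approximating_form X m n.+1%:R^-1 u u @[n --> \oo] --> energy D u u.
Proof.
move=> du; have [_ _ /(_ u u du du) lim] := assoc.
have u0 : (n.+1%:R^-1 : R)%R @[n --> \oo] --> (0 : R)^'+.
  by apply: cvgn_at_right => [n|]; [rewrite invr_gt0|exact: cvg_invSn].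
exact: cvg_comp u0 lim.
Qed.

(** The right-hand side of the Hardy estimate at t = 1/(n+1), multiplied by 2N(n+1); the factor t
    cancels. *)
Let bound_seq a N u (n : nat) : R :=
  (2 * N * (approximating_form X m n.+1%:R^-1 u u + a * \int[m]_x (u x ^+ 2)))%R.

Let bound_seq_cvg a N u : dom D u ->
  bound_seq a N u n @[n --> \oo] --> (2 * N * energy_alpha a u)%R.
Proof.
move=> du; apply: cvgM; first exact: cvg_cst.
by apply: cvgD; [exact: approximating_form_cvg|exact: cvg_cst].
Qed.

(** The loss h - P_t h of h = U f is the occupation integral of f, and [hardy_supermedian] controls
    it where h <= N; hence the indicator of that sublevel set in the weight. *)
Lemma integral_sublevel_le a (f : E -> \bar R) (N : R) u : (0 <= a)%R -> (0 < N)%R ->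
  nonneg_borel f -> lower_semicontinuous f -> dom D u ->
  \int[m]_x ((u x ^+ 2 * \1_[set y | (potential_op X a f y <= N%:E)%E] x)%:E * f x) <=
  (2 * N * energy_alpha a u)%:E.
Proof.
move=> a0 N0 nf lf du.
set h := potential_op X a f; set B := [set y | _].
have nh : nonneg_borel h by exact: nonneg_borel_time_integral.
have mB : measurable (B : set (borel E)).
  rewrite -[X in measurable X]setTI; have mh := nh.1.
  by apply: emeasurable_fun_infty_c.
have mu := dom_measurable du.
have mW : measurable_fun [set: borel E] (fun x : borel E => u x ^+ 2 * \1_B x)%R.
  by apply: measurable_funM; [exact: measurable_funX|exact: measurable_indic].
have W0 x : (0 <= u x ^+ 2 * \1_B x)%R by rewrite mulr_ge0 ?sqr_ge0.
apply: (integral_le_occupation (X := X) (a := a) mW W0 nf lf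
  (b := fun n => (bound_seq a N u n)%:E)) => [n|]; last first.
  apply: cvg_EFin; first exact: nearW.
  exact: bound_seq_cvg.
set t := (n.+1%:R^-1)%R.
have t0 : (0 < t)%R by rewrite invr_gt0.
have hE x : h x = occupation X a t f x + P a t h x.
  by apply: potential_op_decomp => //; exact: ltW.
have nO : nonneg_borel (occupation X a t f) by exact: nonneg_borel_time_integral.
have hle x : P a t h x <= h x by rewrite [leRHS]hE leeDr// nO.2.
have [phi [mphi phi0 hphi uphi]] := hardy_supermedian a0 t0 N0 nh hle.
have mup : measurable_fun [set: borel E] (fun x : borel E => (u x ^+ 2 * phi x)%:E).
  by apply/measurable_EFinP; apply: measurable_funM => //; exact: measurable_funX.
have up0 x : 0 <= (u x ^+ 2 * phi x)%:E by rewrite lee_fin mulr_ge0 ?sqr_ge0.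
have k0 : (0 <= n.+1%:R * (2 * N))%R by rewrite !mulr_ge0// ltW.
apply: (@le_trans _ _ (\int[m]_x ((n.+1%:R * (2 * N))%:E * (u x ^+ 2 * phi x)%:E))).
  apply: ge0_le_integral => //.
  - by move=> x _; rewrite !mule_ge0// ?lee_fin//; exact: nO.2.
  - apply: emeasurable_funM; first exact/measurable_EFinP.
    by apply: measurable_funeM; exact: nO.1.
  - exact: measurable_funeM.
  - move=> x _; have [hN|hN] := pselect (h x <= N%:E); last first.
      rewrite indicE memNset// mulr0 mul0e -EFinM lee_fin.
      apply: mulr_ge0 => //; apply: mulr_ge0 => //; exact: sqr_ge0.
    (* Finiteness lets P_t h x be cancelled between [hE] and [hphi]. *)
    have Phfin : P a t h x \is a fin_num.
      rewrite ge0_fin_numE; last exact: (nonneg_borel_dsg X a t nh).2.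
      by apply: le_lt_trans (hle x) _; apply: le_lt_trans hN (ltry _).
    have : occupation X a t f x <= (2 * N * phi x)%:E.
      by have := hphi x hN; rewrite [leLHS]hE addeC leeD2lE.
    rewrite indicE mem_set// mulr1 => Ophi.
    apply: (@le_trans _ _ ((u x ^+ 2)%:E * (n.+1%:R%:E * (2 * N * phi x)%:E))).
      apply: lee_wpmul2l; first by rewrite lee_fin sqr_ge0.
      exact: lee_wpmul2l.
    rewrite -!EFinM lee_fin le_eqVlt; apply/orP; left; apply/eqP; ring.
rewrite ge0_integralZl//.
apply: (@le_trans _ _ ((n.+1%:R * (2 * N))%:E *
  (t * (approximating_form X m t u u + a * \int[m]_x (u x ^+ 2)))%:E)).
  by apply: lee_wpmul2l => //; exact: uphi.
rewrite -EFinM lee_fin le_eqVlt; apply/orP; left; apply/eqP; rewrite /bound_seq /t.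
by field; rewrite nat1r pnatr_eq0.
Qed.

Variable r : R -> E -> E -> \bar R.
Hypothesis rd : resolvent_density X m r.
Variables (a : R) (mu : {sigma_finite_measure set (borel E) -> \bar R}).
Hypothesis a0 : (0 < a)%R.
Let h x := potential r mu a setT x.

Lemma seq_excessive_potential : seq_excessive X a h.
Proof.
rewrite (_ : h = fun x => \int[mu]_y (r a x y * 1%:E)).
  apply: (seq_excessive_integral mu (rho := fun p => r a p.1 p.2) (w := cst 1%R)) => //.
  - exact: (measurable_density rd a0).
  - exact: (seq_excessive_densityl rd a0).
by apply/funext => x; apply: eq_integral => y _; rewrite mule1.
Qed.

(** Tonelli and the duality identity of the density. [dual_potential_op] is valid at every y, which
    matters because [mu] may charge m-null sets. *)
Lemma integral_potential (g : E -> \bar R) (C : R) : nonneg_borel g ->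
  (forall x, g x <= C%:E) ->
  \int[m]_x (g x * h x) = \int[mu]_y potential_op X a g y.
Proof.
move=> ng gC.
pose F (p : borel E * borel E) := g p.1 * r a p.1 p.2.
have mF : measurable_fun setT F.
  apply: emeasurable_funM; last exact: (measurable_density rd a0).
  exact: measurableT_comp ng.1 measurable_fst.
have F0 p : 0 <= F p by rewrite mule_ge0 ?ng.2// (density_ge0 rd a0).
transitivity (\int[m]_x \int[mu]_y F (x, y)).
  apply: eq_integral => x _; rewrite /h /potential -ge0_integralZl//.
  - by have [[]] := seq_excessive_densityr rd a0 x.
  - by move=> y _; exact: (density_ge0 rd a0).
  - exact: ng.2.
rewrite (@fubini_tonelli _ _ _ _ _ m mu F mF F0); apply: eq_integral => y _.
rewrite -(dual_potential_op symm rd a0 y ng gC).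
by apply: eq_integral => x _; rewrite muleC.
Qed.

(** The weak form of h - P_t h = \int_0^t P_s f ds with the measure [mu] in place of f: tested
    against g dm, the loss of h is the [mu]-integral of the occupation of g. It is kept as a sum
    because the terms may be infinite. *)
Lemma integral_potential_decomp t (g : E -> \bar R) (C : R) : (0 < t)%R ->
  nonneg_borel g -> (forall x, g x <= C%:E) ->
  \int[m]_x (g x * h x) =
  \int[mu]_y occupation X a t g y + \int[m]_x (g x * P a t h x).
Proof.
move=> t0 ng gC; have nPg := nonneg_borel_dsg X a t ng.
have PgC x : P a t g x <= C%:E.
  apply: le_trans (dsg_bound X a t x ng gC) _.
  have C0 : (0 <= C)%R by rewrite -lee_fin; exact: le_trans (ng.2 x) (gC x).
  rewrite lee_fin -[leRHS]mulr1 ler_wpM2l// -expR0 ler_expR oppr_le0.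
  by rewrite mulr_ge0// ltW.
have [nh _ _] := seq_excessive_potential.
rewrite (dsg_sym symm a (ltW t0) ng nh).
rewrite (integral_potential ng gC) (integral_potential nPg PgC).
have nO := nonneg_borel_time_integral X a (measurable_itv `[0%R, t[) ng.
have nU := nonneg_borel_time_integral X a (measurable_itv `[0%R, +oo[) nPg.
rewrite -ge0_integralD//; [|by move=> x _; exact: nO.2|exact: nO.1
  |by move=> x _; exact: nU.2|exact: nU.1].
apply: eq_integral => x _; apply: potential_op_decomp_dsg => //; exact: ltW.
Qed.

(** The m-a.e. domination of g is used only inside integrals over m; the passage to [mu] goes
    through [integral_potential_decomp] and Fatou's lemma. Two functions are allowed so that one of
    them can dominate g on an exceptional open set. *)
Lemma integral_lsc_le (g : E -> \bar R) (C N : R) u1 u2 : (0 < N)%R ->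
  (forall x, h x <= N%:E) ->
  nonneg_borel g -> lower_semicontinuous g -> (forall x, g x <= C%:E) ->
  dom D u1 -> dom D u2 ->
  {ae m, forall x, g x <= (u1 x ^+ 2 + u2 x ^+ 2)%:E} ->
  \int[mu]_x g x <= (2 * N * energy_alpha a u1 + 2 * N * energy_alpha a u2)%:E.
Proof.
move=> N0 hN ng lg gC d1 d2 gu.
have mu1 := dom_measurable d1; have mu2 := dom_measurable d2.
rewrite (_ : \int[mu]_x g x = \int[mu]_x ((cst 1%R x)%:E * g x)); last first.
  by apply: eq_integral => x _; rewrite mul1e.
apply: (integral_le_occupation (X := X) (a := a) (measurable_cst _) (fun=> ler01) ng lg
  (b := fun n => (bound_seq a N u1 n + bound_seq a N u2 n)%:E)) => [n|]; last first.
  apply: cvg_EFin; first exact: nearW.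
  by apply: cvgD; exact: bound_seq_cvg.
set t := (n.+1%:R^-1)%R.
have t0 : (0 < t)%R by rewrite invr_gt0.
have [nh hle _] := seq_excessive_potential.
have [phi [mphi phi0 hphi uphi]] := hardy_supermedian (ltW a0) t0 N0 nh (fun x => hle t x (ltW t0)).
have nO : nonneg_borel (occupation X a t g) by exact: nonneg_borel_time_integral.
have nPh := nonneg_borel_dsg X a t nh.
have nphi : nonneg_borel (fun x => (2 * N * phi x)%:E).
  split=> [|x]; last by rewrite lee_fin !mulr_ge0// ltW.
  by apply/measurable_EFinP; exact: measurable_funM.
have nsq u : dom D u -> nonneg_borel (fun x => (u x ^+ 2)%:E).
  move=> du; split=> [|x]; last by rewrite lee_fin sqr_ge0.
  by apply/measurable_EFinP; apply: measurable_funX; exact: dom_measurable du.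
have nsqp u : dom D u -> nonneg_borel (fun x => (u x ^+ 2 * phi x)%:E).
  move=> du; split=> [|x]; last by rewrite lee_fin mulr_ge0 ?sqr_ge0.
  apply/measurable_EFinP; apply: measurable_funM => //.
  by apply: measurable_funX; exact: dom_measurable du.
have gfin : \int[m]_x g x < +oo.
  apply: (@le_lt_trans _ _ (\int[m]_x ((u1 x ^+ 2)%:E + (u2 x ^+ 2)%:E))).
    apply: ae_ge0_le_integral => //.
    - by move=> x _; exact: ng.2.
    - exact: ng.1.
    - by move=> x _; rewrite adde_ge0// lee_fin sqr_ge0.
    - exact: (nonneg_borelD (nsq _ d1) (nsq _ d2)).1.
    - by apply: ae_imply gu => x gx _; rewrite -EFinD.
  rewrite ge0_integralD//; [|by move=> x _; exact: (nsq _ d1).2|exact: (nsq _ d1).1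
    |by move=> x _; exact: (nsq _ d2).2|exact: (nsq _ d2).1].
  by apply: lte_add_pinfty; exact: dom_square.
(* This term is cancelled in [Ole]; its finiteness comes from the m-integrability that g inherits
   from [u1] and [u2]. *)
have gPfin : \int[m]_x (g x * P a t h x) \is a fin_num.
  rewrite ge0_fin_numE; last by apply: integral_ge0 => x _; exact: (nonneg_borelM ng nPh).2.
  apply: (@le_lt_trans _ _ (\int[m]_x (N%:E * g x))).
    apply: ge0_le_integral => //.
    - by move=> x _; exact: (nonneg_borelM ng nPh).2.
    - exact: (nonneg_borelM ng nPh).1.
    - by apply: measurable_funeM; exact: ng.1.
    - move=> x _; rewrite muleC; apply: lee_wpmul2r; first exact: ng.2.
      exact: le_trans (hle t x (ltW t0)) (hN x).
  rewrite ge0_integralZl//; [|exact: ng.1|by move=> x _; exact: ng.2|by rewrite lee_fin ltW].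
  by rewrite lte_mul_pinfty// lee_fin ltW.
have Ole : \int[mu]_y occupation X a t g y <= \int[m]_x (g x * (2 * N * phi x)%:E).
  rewrite -(leeD2rE _ _ gPfin) -(integral_potential_decomp t0 ng gC).
  rewrite -ge0_integralD//; [|by move=> x _; exact: (nonneg_borelM ng nphi).2
    |exact: (nonneg_borelM ng nphi).1|by move=> x _; exact: (nonneg_borelM ng nPh).2
    |exact: (nonneg_borelM ng nPh).1].
  apply: ge0_le_integral => //.
  - by move=> x _; exact: (nonneg_borelM ng nh).2.
  - exact: (nonneg_borelM ng nh).1.
  - exact: (nonneg_borelD (nonneg_borelM ng nphi) (nonneg_borelM ng nPh)).1.
  - move=> x _; rewrite -ge0_muleDr ?nphi.2 ?nPh.2//.
    by apply: lee_wpmul2l; [exact: ng.2|rewrite addeC; exact: hphi].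
under eq_integral do rewrite mul1e.
rewrite ge0_integralZl//; [|exact: nO.1|by move=> x _; exact: nO.2].
have gphi : \int[m]_x (g x * (2 * N * phi x)%:E) <=
    (2 * N)%:E * (\int[m]_x (u1 x ^+ 2 * phi x)%:E + \int[m]_x (u2 x ^+ 2 * phi x)%:E).
  rewrite -ge0_integralD//; [|by move=> x _; exact: (nsqp _ d1).2|exact: (nsqp _ d1).1
    |by move=> x _; exact: (nsqp _ d2).2|exact: (nsqp _ d2).1].
  rewrite -ge0_integralZl//; [|exact: (nonneg_borelD (nsqp _ d1) (nsqp _ d2)).1
    |by move=> x _; exact: (nonneg_borelD (nsqp _ d1) (nsqp _ d2)).2
    |by rewrite lee_fin mulr_ge0// ltW].
  apply: ae_ge0_le_integral => //.
  - by move=> x _; exact: (nonneg_borelM ng nphi).2.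
  - exact: (nonneg_borelM ng nphi).1.
  - move=> x _; rewrite mule_ge0//; first by rewrite lee_fin mulr_ge0// ltW.
    exact: (nonneg_borelD (nsqp _ d1) (nsqp _ d2)).2.
  - by apply: measurable_funeM; exact: (nonneg_borelD (nsqp _ d1) (nsqp _ d2)).1.
  - apply: ae_imply gu => x gx _.
    apply: (@le_trans _ _ ((u1 x ^+ 2 + u2 x ^+ 2)%:E * (2 * N * phi x)%:E)).
      by apply: lee_wpmul2r => //; exact: nphi.2.
    by rewrite -!EFinD -!EFinM lee_fin le_eqVlt; apply/orP; left; apply/eqP; ring.
apply: (@le_trans _ _ (n.+1%:R%:E * ((2 * N)%:E *
   ((t * (approximating_form X m t u1 u1 + a * \int[m]_x (u1 x ^+ 2)))%:E +
    (t * (approximating_form X m t u2 u2 + a * \int[m]_x (u2 x ^+ 2)))%:E)))).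
  apply: lee_wpmul2l => //; apply: (le_trans Ole); apply: (le_trans gphi).
  apply: lee_wpmul2l; first by rewrite lee_fin mulr_ge0// ltW.
  by apply: leeD; exact: uphi.
rewrite -EFinD -!EFinM lee_fin le_eqVlt; apply/orP; left; apply/eqP; rewrite /bound_seq /t.
by field; rewrite nat1r pnatr_eq0.
Qed.

End form_bounds.

Lemma integral_truncation_le d (T : measurableType d) (R : realType)
    (nu : {measure set T -> \bar R}) (f : T -> R) (M : \bar R) :
  measurable_fun setT f -> (forall x, 0 <= f x)%R ->
  (forall k : nat, \int[nu]_x (Num.min (f x) k%:R)%:E <= M) ->
  \int[nu]_x (f x)%:E <= M.
Proof.
move=> mf f0 fM.
pose g k x : \bar R := (Num.min (f x) k%:R)%:E.
have gf x : limn (g ^~ x) = (f x)%:E.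
  apply/cvg_lim => //; apply: cvg_near_cst; near=> n.
  by rewrite /g; congr (_%:E); apply/min_l; near: n; exact: nbhs_infty_ger.
rewrite (_ : \int[nu]_x (f x)%:E = \int[nu]_x limn (g ^~ x)); last first.
  by apply: eq_integral => x _; rewrite gf.
have gc : \int[nu]_x g k x @[k --> \oo] --> \int[nu]_x limn (g ^~ x).
  apply: cvg_monotone_convergence => //.
  - by move=> n; apply/measurable_EFinP; exact: measurable_minr.
  - by move=> n x _; rewrite /g lee_fin le_min f0/=.
  - move=> x _ n p np; rewrite /g lee_fin le_min ge_min lexx/= ge_min ler_nat np.
    by rewrite orbT.
rewrite -(cvg_lim _ gc)//; apply: lime_le; last by apply: nearW => k; exact: fM.
by apply/cvg_ex; eexists; exact: gc.
Unshelve. all: by end_near. Qed.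

(** * Scaling in the domain of the form *)

Section domain.
Context {R : realType} (E : pmetricType R).
Variable m : {sigma_finite_measure set (borel E) -> \bar R}.
Variable D : dirichlet_form m.

Lemma dom_scale c u : dom D u -> dom D (fun x => c * u x)%R.
Proof.
(* [dom_linear] speaks of a u + v, so the multiple is written with a = c - 1 and v = u. *)
move=> du; rewrite (_ : (fun x => c * u x)%R = (fun x => (c - 1) * u x + u x)%R).
  exact: dom_linear.
by apply/funext => x; ring.
Qed.

Lemma energy_scale c u : dom D u ->
  energy D (fun x => c * u x)%R (fun x => c * u x)%R = (c ^+ 2 * energy D u u)%R.
Proof.
move=> du; have dcu := dom_scale c du.
have scale_l w : dom D w -> energy D (fun x => c * u x)%R w = (c * energy D u w)%R.
  move=> dw; rewrite (_ : (fun x => c * u x)%R = (fun x => (c - 1) * u x + u x)%R).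
    by rewrite energy_linear//; ring.
  by apply/funext => x; ring.
by rewrite scale_l// energy_sym// scale_l//; ring.
Qed.

Lemma integral_square_scale (nu : {measure set (borel E) -> \bar R}) c (u : E -> R) :
  measurable_fun [set: borel E] (u : borel E -> R) ->
  \int[nu]_x ((c * u x) ^+ 2)%:E = (c ^+ 2)%:E * \int[nu]_x (u x ^+ 2)%:E.
Proof.
move=> mu; under eq_integral do rewrite exprMn EFinM.
rewrite ge0_integralZl//.
- by apply/measurable_EFinP; exact: measurable_funX.
- by move=> x _; rewrite lee_fin sqr_ge0.
- by rewrite lee_fin sqr_ge0.
Qed.

Lemma energy_alpha_scale a c u : dom D u ->
  energy_alpha D a (fun x => c * u x)%R = (c ^+ 2 * energy_alpha D a u)%R.
Proof.
move=> du; rewrite /energy_alpha energy_scale// /Rintegral.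
rewrite integral_square_scale; last exact: dom_measurable du.
rewrite fineM//=; first by ring.
rewrite ge0_fin_numE; first exact: dom_square du.
by apply: integral_ge0 => x _; rewrite lee_fin sqr_ge0.
Qed.

Lemma Rintegral_square_ge0 (nu : {measure set (borel E) -> \bar R}) (u : E -> R) :
  (0 <= \int[nu]_x (u x ^+ 2))%R.
Proof. by apply: fine_ge0; apply: integral_ge0 => x _; rewrite lee_fin sqr_ge0. Qed.

Lemma energy_alpha_ge0 a u : (0 <= a)%R -> dom D u -> (0 <= energy_alpha D a u)%R.
Proof.
by move=> a0 du; rewrite addr_ge0 ?energy_ge0// mulr_ge0// Rintegral_square_ge0.
Qed.

Lemma energy_alpha_le a u : (0 <= a)%R -> dom D u ->
  (energy_alpha D a u <= (1 + a) * energy1 D u u)%R.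
Proof.
move=> a0 du; rewrite /energy_alpha /energy1.
under [in leRHS]eq_Rintegral do rewrite -expr2.
have e0 := energy_ge0 du; have s0 := Rintegral_square_ge0 m u.
have := mulr_ge0 a0 e0; lra.
Qed.

End domain.

(** * The form bound for quasi-continuous functions *)

Section quasi_continuous_bound.
Context {R : realType} (E : pmetricType R) (X : hunt_process E).
Variable m : {sigma_finite_measure set (borel E) -> \bar R}.
Variable D : dirichlet_form m.
Hypothesis assoc : associated X D.
Variable r : R -> E -> E -> \bar R.
Hypothesis rd : resolvent_density X m r.
Variables (a : R) (mu : {sigma_finite_measure set (borel E) -> \bar R}) (N : R).
Hypotheses (a0 : (0 < a)%R) (N0 : (0 < N)%R).
Hypothesis potN : forall x, potential r mu a setT x <= N%:E.

(** On [G] the function takes its largest value k, so approach from inside [G] cannot break lower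
    semicontinuity; off [G] it is min(u^2, k), continuous relative to the complement. *)
Lemma truncated_square_lsc (G : set E) (u : E -> R) (k : R) : (0 <= k)%R -> open G ->
  {within ~` G, continuous u} ->
  lower_semicontinuous (fun x => (Num.max (k * \1_G x) (Num.min (u x ^+ 2) k))%:E).
Proof.
move=> k0 oG /subspace_continuousP cu x c.
have gG y : G y -> Num.max (k * \1_G y)%R (Num.min (u y ^+ 2) k)%R = k.
  by move=> Gy; rewrite indicE mem_set// mulr1 max_l// ge_min lexx orbT.
have gnG y : ~ G y ->
    Num.max (k * \1_G y)%R (Num.min (u y ^+ 2) k)%R = Num.min (u y ^+ 2)%R k.
  by move=> Gy; rewrite indicE memNset// mulr0 max_r// le_min sqr_ge0.
rewrite lte_fin; have [Gx|Gx] := pselect (G x).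
  rewrite gG// => ck; exists G; first exact: open_nbhs_nbhs.
  by move=> y Gy; rewrite gG.
rewrite gnG// lt_min => /andP[cux ck].
have : \forall y \near within (~` G) (nbhs x), (c < u y ^+ 2)%R.
  apply: (cvgr_gt (u x ^+ 2)%R) => //.
  by apply: cvgM; exact: cu.
rewrite near_withinE => H; exists [set y | (~` G) y -> (c < u y ^+ 2)%R] => //.
move=> y /= Hy; rewrite lte_fin; have [Gy|Gy] := pselect (G y); first by rewrite gG.
by rewrite gnG// lt_min Hy.
Qed.

Lemma integral_truncated_le u (k : R) : (0 < k)%R -> dom D u -> quasi_continuous D u ->
  \int[mu]_x (Num.min (u x ^+ 2) k)%:E <= (2 * N * energy_alpha D a u)%:E.
Proof.
move=> k0 du qu; apply/lee_addgt0Pr => e e0.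
(* Chosen so that 2N k (1 + a) d, which bounds the contribution of the exceptional set, equals e. *)
pose d := (e / (2 * N * (k * (1 + a))))%R.
have K0 : (0 < 2 * N * (k * (1 + a)))%R by rewrite !mulr_gt0// addr_gt0.
have d0 : (0 < d)%R by rewrite divr_gt0.
have [G [oG]] := qu d d0.
move=> /ereal_inf_lt[_ [w [dw w1] <-]] Gd cu; rewrite lte_fin in Gd.
(* The factor sqrt k makes v^2 >= k m-a.e. on [G]. *)
pose v x := (Num.sqrt k * w x)%R.
have dv : dom D v := dom_scale _ dw.
have mG : measurable (G : set (borel E)) by exact: open_borel.
have mU := dom_measurable du.
pose g x := (Num.max (k * \1_G x) (Num.min (u x ^+ 2) k))%R.
have g0 x : (0 <= g x)%R.
  by rewrite /g le_max mulr_ge0// ltW.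
have ng : nonneg_borel (EFin \o g).
  split=> [|x]; last by rewrite lee_fin.
  apply/measurable_EFinP; apply: measurable_maxr.
    by apply: measurable_funM => //; exact: measurable_indic.
  by apply: measurable_minr => //; exact: measurable_funX.
have gk x : (EFin \o g) x <= k%:E.
  rewrite /= lee_fin /g ge_max ge_min lexx orbT andbT indicE.
  by case: (_ \in _); rewrite ?mulr1// mulr0 ltW.
have lg : lower_semicontinuous (EFin \o g) := truncated_square_lsc (ltW k0) oG cu.
have gle : {ae m, forall x, (EFin \o g) x <= (u x ^+ 2 + v x ^+ 2)%:E}.
  apply: ae_imply w1 => x w1; rewrite /= lee_fin /g ge_max; apply/andP; split.
    rewrite indicE; have [Gx|Gx] := pselect (G x); last first.
      by rewrite memNset// mulr0 addr_ge0 ?sqr_ge0.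
    rewrite mem_set// mulr1 /v exprMn sqr_sqrtr; last exact: ltW.
    have := w1 Gx => w1x.
    have : (1 <= w x ^+ 2)%R by rewrite expr_ge1// (le_trans ler01).
    have := sqr_ge0 (u x); nra.
  by rewrite ge_min lerDl sqr_ge0.
have := integral_lsc_le assoc rd a0 N0 potN ng lg gk du dv gle.
move=> H; apply: (@le_trans _ _ (\int[mu]_x (EFin \o g) x)).
  apply: ge0_le_integral => //.
  - by move=> x _; rewrite lee_fin le_min sqr_ge0 ltW.
  - by apply/measurable_EFinP; apply: measurable_minr => //; exact: measurable_funX.
  - exact: ng.1.
  - by move=> x _; rewrite /= lee_fin /g le_max lexx orbT.
apply: (le_trans H); rewrite -EFinD lee_fin lerD2l.
rewrite energy_alpha_scale// sqr_sqrtr; last exact: ltW.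
have := energy_alpha_le (ltW a0) dw => wle.
apply: (@le_trans _ _ (2 * N * (k * ((1 + a) * d)))%R).
  rewrite ler_pM2l ?mulr_gt0// ler_pM2l//; apply: (le_trans wle).
  by rewrite ler_pM2l ?addr_gt0// ltW.
rewrite (_ : 2 * N * (k * ((1 + a) * d)) = d * (2 * N * (k * (1 + a))))%R; last by ring.
by rewrite /d divfK// gt_eqF.
Qed.

Lemma quasi_continuous_integral_le u : dom D u -> quasi_continuous D u ->
  \int[mu]_x (u x ^+ 2)%:E <= (2 * N * energy_alpha D a u)%:E.
Proof.
move=> du qu; apply: integral_truncation_le => [|x|k].
- by apply: measurable_funX; exact: dom_measurable du.
- exact: sqr_ge0.
have [->|k0] := posnP k.
  rewrite integral0_eq ?lee_fin ?mulr_ge0 ?energy_alpha_ge0// ?ltW// => x _.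
  by rewrite min_r// sqr_ge0.
by apply: integral_truncated_le => //; rewrite ltr0n.
Qed.

End quasi_continuous_bound.

Lemma indic_open_lsc (R : realType) (T : topologicalType) (G : set T) : open G ->
  lower_semicontinuous (fun x => (\1_G x : R)%:E).
Proof.
move=> oG x c; rewrite lte_fin indicE; have [Gx|Gx] := pselect (G x).
  rewrite mem_set// => c1; exists G; first exact: open_nbhs_nbhs.
  by move=> y Gy; rewrite lte_fin indicE mem_set.
rewrite memNset// => c0; exists setT; first exact: filterT.
by move=> y _; rewrite lte_fin (lt_le_trans c0)// indicE ler0n.
Qed.

Lemma nonneg_borel_indic (R : realType) (E : pmetricType R) (A : set (borel E)) :
  measurable A -> nonneg_borel (fun x : E => (\1_A x : R)%:E).
Proof.
move=> mA; split=> [|x]; last by rewrite lee_fin.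
by apply/measurable_EFinP; exact: measurable_indic.
Qed.

(** * The Poincare inequality *)

Section poincare.
Context {R : realType} (E : pmetricType R) (X : hunt_process E).
Variable m : {sigma_finite_measure set (borel E) -> \bar R}.
Variable D : dirichlet_form m.
Hypothesis assoc : associated X D.
Hypothesis sf : strong_feller X.
Variable r : R -> E -> E -> \bar R.
Hypothesis rd : resolvent_density X m r.

Lemma potential_op_densityE a f x : (0 <= a)%R -> nonneg_borel f ->
  potential_op X a f x = \int[m]_y (r a x y * f y).
Proof.
by move=> a0 nf; have [_ rE _ _] := rd a0; rewrite -resolvent_potential_op// rE.
Qed.

Lemma seq_excessive_potential_op a (w : E -> R) : (0 <= a)%R ->
  measurable_fun [set: borel E] (w : borel E -> R) -> (forall y, 0 <= w y)%R ->
  seq_excessive X a (potential_op X a (EFin \o w)).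
Proof.
move=> a0 mw w0; have [mr _ _ er] := rd a0.
have nw : nonneg_borel (EFin \o w).
  by split=> [|x]; [exact/measurable_EFinP|rewrite lee_fin].
rewrite (_ : potential_op X a _ = fun x => \int[m]_y (r a x y * (w y)%:E)).
  apply: (seq_excessive_integral m (rho := fun p => r a p.1 p.2)) => // y.
  exact: (excessive_seq_excessive (er y)).
by apply/funext => x; exact: potential_op_densityE.
Qed.

Lemma potential_op_le a (f g : E -> \bar R) x : nonneg_borel f -> nonneg_borel g ->
  (forall y, f y <= g y) -> potential_op X a f x <= potential_op X a g x.
Proof.
move=> nf ng fg; apply: ge0_le_integral => //.
- by move=> s _; exact: (nonneg_borel_dsg X a s nf).2.
- by apply: measurable_funTS; exact: measurable_dsg_time.
- by apply: measurable_funTS; exact: measurable_dsg_time.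
- by move=> s _; exact: dsg_le.
Qed.

(* U f is the uniform limit, as t -> 0, of the continuous functions P_t U f. *)
Lemma open_potential_op_lt a (f : E -> \bar R) (c : R) : (0 < a)%R ->
  nonneg_borel f -> (forall y, f y <= 1) ->
  open [set x | potential_op X a f x < c%:E].
Proof.
move=> a0 nf f1; set h := potential_op X a f.
have nh : nonneg_borel h by exact: nonneg_borel_time_integral.
have ha x : h x <= (1 / a)%:E by exact: potential_op_bound.
have hfin x : h x \is a fin_num.
  by rewrite ge0_fin_numE ?nh.2// (le_lt_trans (ha x))// ltry.
rewrite openE => x /= hc; rewrite /interior.
pose t := ((c - fine (h x)) / 2)%R.
have t0 : (0 < t)%R by rewrite divr_gt0// subr_gt0 -lte_fin fineK.
have Pfin y : dsg X a t h y \is a fin_num.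
  rewrite ge0_fin_numE; last exact: (nonneg_borel_dsg X a t nh).2.
  exact: le_lt_trans (dsg_bound X a t y nh ha) (ltry _).
have hE y : h y = occupation X a t f y + dsg X a t h y.
  by apply: potential_op_decomp => //; exact: ltW.
have occ0 y : 0 <= occupation X a t f y.
  by apply: integral_ge0 => s _; exact: (nonneg_borel_dsg X a s nf).2.
have occt y : occupation X a t f y <= t%:E.
  rewrite -[X in _ <= X%:E]mul1r; apply: occupation_le => // [|s /andP[s0 _]]; first exact: ltW.
  apply: le_trans (dsg_bound X a s y nf f1) _.
  by rewrite mul1r lee_fin -expR0 ler_expR oppr_le0 mulr_ge0// ltW.
have cP : continuous (fun y => fine (dsg X a t h y)).
  exact: dsg_continuous t0 nh ha.
have : \forall y \near x, (fine (dsg X a t h y) < c - t)%R.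
  apply: (cvgr_lt (fine (dsg X a t h x))); first exact: cP.
  apply: (@le_lt_trans _ _ (fine (h x))).
    by rewrite fine_le// [leRHS]hE leeDr.
  by rewrite /t; have := t0; rewrite /t; lra.
apply: filterS => y yc /=; rewrite hE -(fineK (Pfin y)).
apply: (@le_lt_trans _ _ (t%:E + (fine (dsg X a t h y))%:E)).
  by rewrite leeD2r.
by rewrite -EFinD lte_fin; lra.
Qed.

(** Absolute continuity gives the limit at each point x: the density [r 1 x] is an integrable
    envelope, as U_1 1 <= 1, and the superlevel sets decrease to an m-null set. *)
Lemma potential_op_superlevel_cvg0 (h : E -> \bar R) x : nonneg_borel h ->
  {ae m, forall y, h y < +oo} ->
  potential_op X 1 (fun y => (\1_[set z | (n%:R%:E < h z)%E] y)%:E) x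
    @[n --> \oo] --> 0.
Proof.
move=> nh hfin; have [[mrx rx0] _ _] := seq_excessive_densityr rd ltr01 x.
have mB n : measurable ([set z | n%:R%:E < h z] : set (borel E)).
  rewrite -[X in measurable X]setTI; have mh := nh.1.
  exact: emeasurable_fun_o_infty.
have nB n := nonneg_borel_indic (mB n).
under eq_fun do rewrite (potential_op_densityE _ ler01)//.
have n1 : nonneg_borel (cst 1%:E : E -> \bar R) := nonneg_borel_cst E ler01.
have [] // := @dominated_convergence _ _ _ m setT measurableT
    (fun n y => r 1 x y * (\1_[set z | (n%:R%:E < h z)%E] y)%:E) (cst 0) (r 1 x);
  last by rewrite integral0.
- by move=> n; apply: emeasurable_funM => //; exact: (nB n).1.
- apply: ae_imply hfin => y hy _ /=.
  have yfin : h y \is a fin_num by rewrite ge0_fin_numE// nh.2.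
  apply: cvg_near_cst; near=> n.
  rewrite indicE memNset ?mule0//=; apply/negP; rewrite -(fineK yfin) lte_fin -leNgt.
  by near: n; exact: nbhs_infty_ger.
- apply/integrableP; split => //.
  under eq_integral do rewrite gee0_abs// -[r 1 x _]mule1.
  have U1 := potential_op_densityE x ler01 n1; rewrite /= in U1; rewrite -U1.
  apply: le_lt_trans (potential_op_bound X (C := 1) x ltr01 n1 _) (ltry _).
  by move=> y.
- apply: aeW => n y _; rewrite gee0_abs; last by rewrite mule_ge0// lee_fin.
  rewrite -[leRHS]mule1; apply: lee_wpmul2l => //.
  by rewrite lee_fin indicE; case: (_ \in _).
Unshelve. all: by end_near. Qed.

Hypotheses (E_lcs : lcs_metric E) (m_radon : radon_full_support m).
Hypothesis transient : transient_semigroup X m.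
Hypothesis small : forall e : R, (0 < e)%R -> exists2 K : set E,
  compact K & sup_potential r m 0 (~` K) < e%:E.

Lemma poincare : exists2 C : R, (0 < C)%R & forall u, dom D u ->
  \int[m]_x (u x ^+ 2)%:E <= (C * energy D u u)%:E.
Proof.
(* Level 1/4 gives the coefficient 1/2 in [integral_sublevel_le]. *)
have q0 : (0 < 4^-1 :> R)%R by rewrite invr_gt0.
have [K cK Ksmall] := small q0.
have [G [oG mG KG]] := compact_finite_measure_open E_lcs m_radon cK.
have oK : open (~` K).
  by rewrite openC; apply: compact_closed => //; exact: metric_hausdorff.
have nK : nonneg_borel (fun x : E => (\1_(~` K) x : R)%:E).
  by apply: nonneg_borel_indic; exact: open_borel.
have nG : nonneg_borel (fun x : E => (\1_G x : R)%:E).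
  by apply: nonneg_borel_indic; exact: open_borel.
pose h := potential_op X 0 (fun x => (\1_G x)%:E).
have eh : seq_excessive X 0 h.
  apply: (seq_excessive_potential_op (w := fun x => \1_G x) (lexx 0%R)) => //.
  by apply: measurable_indic; exact: open_borel.
have nh : nonneg_borel h by case: eh.
(* [G] has finite measure, so its indicator is integrable and transience applies. *)
have hfin : {ae m, forall y, h y < +oo}.
  have : {ae m, forall y, resolvent X 0 (fun x => (\1_G x)%:E) y < +oo}.
    apply: transient => //; rewrite integral_indic ?setIT//; exact: open_borel.
  by apply: ae_imply => y; rewrite resolvent_potential_op.
pose B n : set E := [set z | n%:R%:E < h z].
have oB n : open (B n).
  exact: (iffLR (lower_semicontinuousP h) (seq_excessive_lsc sf eh)).
have BB n p : (n <= p)%N -> B p `<=` B n.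
  by move=> np z; apply: le_lt_trans; rewrite lee_fin ler_nat.
have nB n : nonneg_borel (fun x : E => (\1_(B n) x : R)%:E).
  by apply: nonneg_borel_indic; exact: open_borel.
pose f n x : \bar R := potential_op X 1 (fun y => (\1_(B n) y)%:E) x.
have ff n p x : (n <= p)%N -> f p x <= f n x.
  move=> np; apply: potential_op_le => // y; rewrite lee_fin !indicE ler_nat.
  have [Bp|Bp] := pselect (B p y); last by rewrite (memNset Bp).
  by rewrite !mem_set//; exact: BB np _ Bp.
(* The sets on the right are open, increase with n and cover [K]. *)
have [n Kn] : exists n, K `<=` [set x | f n x < (4^-1)%:E].
  apply: compact_increasing_cover => //.
  - move=> n; apply: open_potential_op_lt => // y.
    by rewrite lee_fin indicE; case: (_ \in _).
  - by move=> n p np x /=; apply: le_lt_trans; exact: ff.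
  - move=> x _; have := @potential_op_superlevel_cvg0 h x nh hfin.
    have fq : nbhs (0 : \bar R) [set y | y < (4^-1)%:E].
      by apply: open_nbhs_nbhs; split; [exact: open_ereal_lt_ereal|rewrite /= lte_fin].
    by move=> /(_ _ fq) [n _ /(_ n (leqnn n))] fn; exists n.
(* The successor keeps N positive even when n = 0. *)
pose N : R := n.+1%:R.
have N0 : (0 < N)%R by rewrite ltr0n.
have KU x : potential_op X 0 (fun y => (\1_(~` K) y)%:E) x <= (4^-1)%:E.
  rewrite potential_op_densityE//; apply: le_trans (ltW Ksmall).
  apply: ereal_sup_ubound; exists x => //.
  rewrite /potential integral_mkcond; apply: eq_integral => y _.
  rewrite patchE indicE; case: (_ \in _); by rewrite ?mule1 ?mule0.
(* With S = \int u^2 dm and e = E(u,u), the three bounds add up to S <= e/2 + 2N e + (e + S)/2, that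
   is, S <= (2 + 4N) e. *)
exists (2 + 4 * N)%R; first by rewrite addr_gt0// mulr_gt0.
move=> u du.
pose w A x := (u x ^+ 2 * \1_A x)%R.
pose A1 : set E := [set y | potential_op X 0 (fun y => (\1_(~` K) y)%:E) y <= (4^-1)%:E].
pose A2 : set E := [set y | h y <= N%:E].
pose A3 : set E := [set y | f n.+1 y <= (4^-1)%:E].
have H1 := integral_sublevel_le assoc (lexx 0%R) q0 nK (indic_open_lsc oK) du.
have H2 := integral_sublevel_le assoc (lexx 0%R) N0 nG (indic_open_lsc oG) du.
have H3 := integral_sublevel_le assoc ler01 q0 (nB n.+1) (indic_open_lsc (oB n.+1)) du.
have mu2 : measurable_fun [set: borel E] (fun x : borel E => u x ^+ 2)%R.
  by apply: measurable_funX; exact: dom_measurable du.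
have mpot a g (c : R) : nonneg_borel g ->
    measurable ([set y | potential_op X a g y <= c%:E] : set (borel E)).
  move=> ng; rewrite -[X in measurable X]setTI.
  have [mp _] := nonneg_borel_time_integral X a (measurable_itv `[0%R, +oo[) ng.
  by apply: emeasurable_fun_infty_c.
have nw A g : measurable (A : set (borel E)) -> nonneg_borel g ->
    nonneg_borel (fun x => (w A x)%:E * g x).
  move=> mA ng; apply: nonneg_borelM => //; split=> [|x].
    by apply/measurable_EFinP; apply: measurable_funM => //; exact: measurable_indic.
  by rewrite lee_fin mulr_ge0 ?sqr_ge0.
have n1 : nonneg_borel (fun x => (w A1 x)%:E * (\1_(~` K) x)%:E) by exact: nw (mpot _ _ _ nK) nK.
have n2 : nonneg_borel (fun x => (w A2 x)%:E * (\1_G x)%:E) by exact: nw (mpot _ _ _ nG) nG.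
have n3 : nonneg_borel (fun x => (w A3 x)%:E * (\1_(B n.+1) x)%:E).
  exact: nw (mpot _ _ _ (nB n.+1)) (nB n.+1).
have S0 : (0 <= \int[m]_x (u x ^+ 2)%:E) by apply: integral_ge0 => x _; rewrite lee_fin sqr_ge0.
have Sfin : \int[m]_x (u x ^+ 2)%:E \is a fin_num.
  by rewrite ge0_fin_numE//; exact: dom_square du.
have : \int[m]_x (u x ^+ 2)%:E <=
  \int[m]_x ((w A1 x)%:E * (\1_(~` K) x)%:E) +
  (\int[m]_x ((w A2 x)%:E * (\1_G x)%:E) + \int[m]_x ((w A3 x)%:E * (\1_(B n.+1) x)%:E)).
  have n23 := nonneg_borelD n2 n3; have n123 := nonneg_borelD n1 n23.
  rewrite -ge0_integralD//; [|by move=> x _; exact: n2.2|exact: n2.1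
    |by move=> x _; exact: n3.2|exact: n3.1].
  rewrite -ge0_integralD//; [|by move=> x _; exact: n1.2|exact: n1.1
    |by move=> x _; exact: n23.2|exact: n23.1].
  apply: ge0_le_integral => //.
  - by move=> x _; rewrite lee_fin sqr_ge0.
  - exact/measurable_EFinP.
  - exact: n123.1.
  move=> x _; have [Kx|Kx] := pselect (K x); last first.
    apply: (@le_trans _ _ ((w A1 x)%:E * (\1_(~` K) x)%:E)); last first.
      by rewrite leeDl// n23.2.
    by rewrite /w !indicE !mem_set// ?mule1 ?mulr1//; exact: KU.
  apply: (@le_trans _ _ ((w A2 x)%:E * (\1_G x)%:E + (w A3 x)%:E * (\1_(B n.+1) x)%:E)); last first.
    by rewrite leeDr// n1.2.
  have [hx|hx] := leP (h x) N%:E.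
    apply: (@le_trans _ _ ((w A2 x)%:E * (\1_G x)%:E)); last by rewrite leeDl// n3.2.
    by rewrite /w !indicE !mem_set// ?mule1 ?mulr1//; exact: KG.
  apply: (@le_trans _ _ ((w A3 x)%:E * (\1_(B n.+1) x)%:E)); last by rewrite leeDr// n2.2.
  rewrite /w !indicE !mem_set// ?mule1 ?mulr1//.
  by apply: le_trans (ff n n.+1 x (leqnSn n)) _; apply/ltW; exact: Kn.
move=> /le_trans /(_ (leeD H1 (leeD H2 H3))).
rewrite -(fineK Sfin) -!EFinD !lee_fin /energy_alpha.
rewrite (_ : \int[m]_x (u x ^+ 2) = fine (\int[m]_x (u x ^+ 2)%:E))%R//.
by rewrite !mul0r !addr0; set S := fine _; set e := energy _ _ _; lra.
Qed.

End poincare.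

(** * Comparison of the two spectral bounds *)

Section spectral_bounds.
Context {R : realType} (E : pmetricType R).
Variable m : {sigma_finite_measure set (borel E) -> \bar R}.
Variable D : dirichlet_form m.
Variable mu : {measure set (borel E) -> \bar R}.

Lemma quasi_continuous_scale c u : quasi_continuous D u ->
  quasi_continuous D (fun x => c * u x)%R.
Proof.
move=> qu e /qu [G [oG Ge cu]]; exists G; split=> // x.
by apply: cvgM; [exact: cvg_cst|exact: cu].
Qed.

Let sq (nu : {measure set (borel E) -> \bar R}) (u : E -> R) : R := (\int[nu]_x (u x ^+ 2))%R.

Let sqE (nu : {measure set (borel E) -> \bar R}) (u : E -> R) :
  \int[nu]_x (u x ^+ 2)%:E < +oo -> \int[nu]_x (u x ^+ 2)%:E = (sq nu u)%:E.
Proof.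
move=> ufin; rewrite /sq /Rintegral fineK// ge0_fin_numE//.
by apply: integral_ge0 => x _; rewrite lee_fin sqr_ge0.
Qed.

Lemma integral_square_normalize (nu : {measure set (borel E) -> \bar R}) (u : E -> R) (s : R) :
  measurable_fun [set: borel E] (u : borel E -> R) -> (0 < s)%R ->
  \int[nu]_x (u x ^+ 2)%:E = s%:E ->
  \int[nu]_x (((Num.sqrt s)^-1 * u x) ^+ 2)%:E = 1.
Proof.
move=> mu' s0 us; rewrite integral_square_scale// us -EFinM exprVn sqr_sqrtr; last exact: ltW.
by rewrite mulVf// gt_eqF.
Qed.

(** A strict inequality for one infimum leaves a margin, l > 1 or c > 0. Scaling extends it to all
    quasi-continuous u in the domain, and a coercivity bound turns it into a margin for the other
    infimum. *)
Lemma lambda_gt1_gamma_gt0 (a C : R) : (0 < a)%R -> (0 < C)%R ->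
  (forall u, dom D u -> quasi_continuous D u ->
    \int[mu]_x (u x ^+ 2)%:E <= (2^-1 * energy_alpha D a u)%:E) ->
  (forall u, dom D u -> \int[m]_x (u x ^+ 2)%:E <= (C * energy D u u)%:E) ->
  1 < lambda D mu <-> 0 < gamma D mu.
Proof.
move=> a0 C0 muE mE.
have mufin u : dom D u -> quasi_continuous D u ->
    \int[mu]_x (u x ^+ 2)%:E = (sq mu u)%:E.
  by move=> du qu; apply: sqE; exact: le_lt_trans (muE u du qu) (ltry _).
have mfin u : dom D u -> \int[m]_x (u x ^+ 2)%:E = (sq m u)%:E.
  by move=> du; apply: sqE; exact: dom_square du.
have s0 (nu : {measure set (borel E) -> \bar R}) u : (0 <= sq nu u)%R.
  exact: Rintegral_square_ge0.
have scaleE s u : dom D u -> (0 < s)%R ->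
    energy D (fun x => (Num.sqrt s)^-1 * u x)%R (fun x => (Num.sqrt s)^-1 * u x)%R =
    (energy D u u / s)%R.
  move=> du ps; rewrite energy_scale// exprVn sqr_sqrtr; last exact: ltW.
  by rewrite mulrC.
split=> [/lte_real_between[l l1 lL]|/lte_real_between[c c0 cG]].
  have l0 : (0 < l)%R by exact: lt_trans ltr01 l1.
  have le u : dom D u -> quasi_continuous D u -> (l * sq mu u <= energy D u u)%R.
    move=> du qu; have [b0|b0] := leP (sq mu u) 0%R.
      have -> : sq mu u = 0%R by apply/eqP; rewrite eq_le b0 s0.
      by rewrite mulr0 energy_ge0.
    rewrite -ler_pdivlMr// -scaleE// -lee_fin; apply: (le_trans (ltW lL)).
    apply: ereal_inf_lbound; exists (fun x => (Num.sqrt (sq mu u))^-1 * u x)%R => //.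
    split; [exact: dom_scale|exact: quasi_continuous_scale|].
    by apply: integral_square_normalize => //; [exact: dom_measurable du|exact: mufin].
  (* If \int u^2 dm = 1, then \int u^2 dmu <= E/l and E >= 1/C, so the difference is at least (1 -
     1/l) E >= (1 - 1/l)/C. *)
  apply: (@lt_le_trans _ _ ((1 - l^-1) / C)%:E).
    by rewrite lte_fin divr_gt0// subr_gt0 invf_lt1.
  apply: le_ereal_inf_tmp => _ [u [du qu u1] <-].
  rewrite mufin// -EFinB lee_fin ler_pdivrMr//.
  have := mE u du; rewrite u1 lee_fin => Ce.
  have := le u du qu; rewrite -ler_pdivlMl// => bl.
  apply: (@le_trans _ _ ((1 - l^-1) * (C * energy D u u))%R).
    by rewrite ler_peMr// subr_ge0 invf_le1// ltW.
  rewrite mulrCA mulrC ler_pM2r//; lra.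
have le u : dom D u -> quasi_continuous D u ->
    (sq mu u + c * sq m u <= energy D u u)%R.
  (* If \int u^2 dm = 0, then u cannot be normalised, but the bound for [mu] alone gives \int u^2
     dmu <= E/2. *)
  move=> du qu; have [b0|b0] := leP (sq m u) 0%R.
    have mu0 : sq m u = 0%R by apply/eqP; rewrite eq_le b0 s0.
    have := muE u du qu; rewrite mufin// lee_fin /energy_alpha -/(sq m u) mu0.
    by have := energy_ge0 du; lra.
  have := s0 mu u => mu0.
  have : c%:E <= (energy D u u / sq m u - sq mu u / sq m u)%:E.
    apply: (le_trans (ltW cG)); apply: ereal_inf_lbound.
    exists (fun x => (Num.sqrt (sq m u))^-1 * u x)%R.
      split; [exact: dom_scale|exact: quasi_continuous_scale|].
      by apply: integral_square_normalize => //; [exact: dom_measurable du|exact: mfin].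
    rewrite scaleE// integral_square_scale; last exact: dom_measurable du.
    rewrite mufin// -EFinM -EFinB exprVn sqr_sqrtr; last exact: ltW.
    by rewrite [(_^-1 * _)%R]mulrC.
  rewrite lee_fin -mulrBl ler_pdivlMr//; lra.
have ac : (0 < a + c)%R by rewrite addr_gt0.
(* With s = \int u^2 dm and \int u^2 dmu = 1, one has E >= 1 + c s and E >= 2 - a s. Adding a times
   the first to c times the second eliminates s. *)
apply: (@lt_le_trans _ _ ((a + 2 * c) / (a + c))%:E).
  by rewrite lte_fin ltr_pdivlMr//; lra.
apply: le_ereal_inf_tmp => _ [u [du qu u1] <-].
have mu1 : sq mu u = 1%R by have := mufin u du qu; rewrite u1 => -[].
have := le u du qu; rewrite mu1 => e1.
have := muE u du qu; rewrite u1 lee_fin /energy_alpha -/(sq m u) => e2.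
rewrite lee_fin ler_pdivrMr//.
have : (0 <= a * (energy D u u - 1 - c * sq m u))%R by apply: mulr_ge0; [exact: ltW|lra].
have : (0 <= c * (energy D u u + a * sq m u - 2))%R by apply: mulr_ge0; [exact: ltW|lra].
nra.
Qed.

End spectral_bounds.

(** * Assembly of the equivalence *)

Section sigma_finite_reference.
Context {R : realType} (E : pmetricType R) (X : hunt_process E).
Variable m : {sigma_finite_measure set (borel E) -> \bar R}.
Variables (D : dirichlet_form m) (mu : {measure set (borel E) -> \bar R}).
Variable r : R -> E -> E -> \bar R.

Lemma lambda_gt1_gamma_gt0_sigma_finite :
  lcs_metric E -> radon_full_support m -> associated X D -> transient_semigroup X m ->
  strong_feller X -> resolvent_density X m r ->
  kato_infty D X r m -> kato_infty D X r mu ->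
  1 < lambda D mu <-> 0 < gamma D mu.
Proof.
move=> E_lcs m_radon assoc trans sf rd [_ m_small] [[_ mu_kato] _].
have [C C0 mE] := poincare assoc sf rd E_lcs m_radon trans m_small.
(* A potential bounded by N = 1/4 yields the coefficient 2N = 1/2 that [lambda_gt1_gamma_gt0] asks
   for. *)
have q0 : (0 < 4^-1 :> R)%R by rewrite invr_gt0.
have [a [a0 pota]] : exists a : R, (0 < a)%R /\
    sup_potential r mu a setT < (4^-1)%:E.
  have fq : nbhs (0 : \bar R) [set y | y < (4^-1)%:E].
    by apply: open_nbhs_nbhs; split; [exact: open_ereal_lt_ereal|rewrite /= lte_fin].
  have H : \forall a \near +oo%R, (0 < a)%R /\ sup_potential r mu a setT < (4^-1)%:E.
    by apply: filterI; [exact: nbhs_pinfty_gt|exact: mu_kato _ fq].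
  by have [a Ha] := filter_ex H; exists a.
have potN x : potential r mu a setT x <= (4^-1)%:E.
  by apply: le_trans (ltW pota); apply: ereal_sup_ubound; exists x.
have [symm _ _] := assoc.
have [mu' mu'E] := sigma_finite_pack (potential_sigma_finite sf symm rd a0 E_lcs potN).
apply: (lambda_gt1_gamma_gt0 a0 C0 _ mE) => u du qu; rewrite -mu'E in potN *.
have := quasi_continuous_integral_le assoc rd a0 q0 potN du qu.
by rewrite (_ : 2 * 4^-1 = 2^-1)%R//; field.
Qed.

End sigma_finite_reference.

Theorem theorem4p12 (R : realType) (E : pmetricType R)
    (m mu : {measure set (borel E) -> \bar R})
    (D : dirichlet_form m) (X : hunt_process E)
    (r : R -> E -> E -> \bar R)
    (E_lcs : lcs_metric E)
    (m_radon : radon_full_support m)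
    (D_regular : regular_form D)
    (X_assoc : associated X D)
    (D_transient : transient_semigroup X m)
    (X_irreducible : irreducible_process X m)
    (X_strong_feller : strong_feller X)
    (r_density : resolvent_density X m r)
    (m_kato : kato_infty D X r m)
    (mu_kato : kato_infty D X r mu) :
  1 < lambda D mu <-> 0 < gamma D mu.
Proof.
clear D_regular X_irreducible.
have [m' m'E] := sigma_finite_pack (radon_sigma_finite E_lcs m_radon).
(* Eliminating the equality replaces [m] by its sigma-finite copy in the types of the form and of
   the hypotheses. *)
case: m / m'E D m_radon X_assoc D_transient r_density m_kato mu_kato => D *.
exact: (@lambda_gt1_gamma_gt0_sigma_finite _ _ X m' D mu r).
Qed.
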